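(* Let $\mathfrak A\subset\mathfrak B$ be an inclusion of nets, both satisfying relative duality. Then there is an induced structure preserving inclusion of tensor $C^*$-categories of $\mathcal T_t(\mathfrak A)$ in $\mathcal T_t(\mathfrak B)$ (i.e. a tensor $^*$-functor) which on objects sends a localized transportable endomorphism $\rho\in\Delta_t(\mathfrak A)$ to its canonical extension $\tilde\rho\in\Delta_t(\mathfrak B)$, and which on intertwiners is the given inclusion $\mathfrak A\subset\mathfrak B$.
   Context: Minkowski space has more than two dimensions. $\mathcal K$ is the set of double cones ordered under inclusion and $\mathcal O'$ is the spacelike complement of $\mathcal O$. A net $\mathfrak A$ is an inclusion-preserving assignment $\mathcal O\mapsto\mathfrak A(\mathcal O)$, $\mathcal O\in\mathcal K$, of unital $C^*$-algebras; the same symbol $\mathfrak A$ denotes the $C^*$-algebra generated by all $\mathfrak A(\mathcal O)$, and $\mathfrak A(\mathcal O')$ the $C^*$-subalgebra generated by the $\mathfrak A(\mathcal O_1)$, $\mathcal O_1\subset\mathcal O'$. Relative duality: $\mathfrak A(\mathcal O)=\mathfrak A(\mathcal O')'\cap\mathfrak A$ for all $\mathcal O\in\mathcal K$. An inclusion $\mathfrak A\subset\mathfrak B$ means compatible unital inclusions $\mathfrak A(\mathcal O)\subset\mathfrak B(\mathcal O)$. An endomorphism $\rho$ of $\mathfrak A$ is localized in $\mathcal O$ if $\rho(A)=A$ for $A\in\mathfrak A(\mathcal O')$; it is transportable if for each double cone $\mathcal O_1$ there is a unitary $u\in\mathfrak A$ such that $\mathrm{Ad}\,u\circ\rho$ is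 localized in $\mathcal O_1$. $\Delta_t(\mathfrak A)$ is the set of endomorphisms that are localized in some double cone and transportable. $\mathcal T_t(\mathfrak A)$ is the tensor $C^*$-category with objects $\Delta_t(\mathfrak A)$, arrows the intertwiners $(\rho,\sigma)=\{T\in\mathfrak A: T\rho(A)=\sigma(A)T,\ A\in\mathfrak A\}$, tensor product $\rho\otimes\sigma=\rho\sigma$ (composition) on objects and $T\otimes T'=T\rho(T')$ for $T\in(\rho,\sigma)$, $T'\in(\rho',\sigma')$. Simplices: $0$-simplices are double cones; a $1$-simplex $b=(\mathcal O,\mathcal O_0,\mathcal O_1)$ consists of double cones with $\mathcal O_0\cup\mathcal O_1\subset\mathcal O$, $\partial_0b=\mathcal O_0$, $\partial_1b=\mathcal O_1$, $|b|=\mathcal O$; a $2$-simplex $c=(\mathcal O,\mathcal O_0,\mathcal O_1,\mathcal O_2,\mathcal O_{01},\mathcal O_{02},\mathcal O_{12})$ consists of double cones with $\mathcal O_0\cup\mathcal O_1\cup\mathcal O_2\subset\mathcal O$ whose faces $\partial_0c=(\mathcal O_0,\mathcal O_{01},\mathcal O_{02})$, $\partial_1c=(\mathcal O_1,\mathcal O_{01},\mathcal O_{12})$, $\partial_2c=(\mathcal O_2,\mathcal O_{02},\mathcal O_{12})$ are $1$-simplices. $\Sigma_n$ is the set of $n$-simplices. A $1$-cocycle of $\mathfrak A$ is a map $z$ from $\Sigma_1$ to the unitaries of $\mathfrak A$ with $z(b)\in\mathfrak A(|b|)$ and $z(\partial_0c)z(\partial_2c)=z(\partial_1c)$, $c\in\Sigma_2$.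 Canonical extension: a $1$-cocycle $z$ of $\mathfrak A$ defines a field of endomorphisms $\rho_a$, $a\in\Sigma_0$, of $\mathfrak A$ by $\rho_a(A)=z(b)Az(b)^*$ for $A\in\mathfrak A(\mathcal O)$, $\partial_0b=a$, $\partial_1b\subset\mathcal O'$, and likewise a field $\tilde\rho_a$ of endomorphisms of $\mathfrak B$ by $\tilde\rho_a(B)=z(b)Bz(b)^*$ for $B\in\mathfrak B(\mathcal O)$, $\partial_0b=a$, $\partial_1b\subset\mathcal O'$. Every $\rho\in\Delta_t(\mathfrak A)$ localized in $a$ equals $\rho_a$ for some such $z$ (namely $z(b)=\psi(\partial_0b)\psi(\partial_1b)^*$ where the $\psi(a')\in\mathfrak A$ are unitaries with $\mathrm{Ad}\,\psi(a')\circ\rho$ localized in $a'$ and $\psi(a)=I$); the canonical extension is $\tilde\rho:=\tilde\rho_a$, which does not depend on the choice of $z$. *)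

(* Defs.v *)
From HB Require Import structures.
From mathcomp Require Import all_boot all_order all_algebra.
From mathcomp Require Import ring lra.
From mathcomp Require Import complex.
From mathcomp Require Import boolp classical_sets reals topology normedtype.

Set Implicit Arguments.
Unset Strict Implicit.
Unset Printing Implicit Defensive.

Import Order.TTheory GRing.Theory Num.Theory.
Import numFieldNormedType.Exports.
Local Open Scope classical_set_scope.
Local Open Scope complex_scope.
Local Open Scope ring_scope.

(* Norms are functions into R on modules over R[i]: the library hierarchy has
   no join of its normed modules with (noncommutative) rings. *)
Definition banach_norm (R : realType) (V : lmodType R[i]) (N : V -> R) : Prop :=
  [/\ forall v, N v = 0 -> v = 0,
      forall v w, N (v + w) <= N v + N w,
      forall (k : R[i]) v, (N (k *: v))%:C = `|k| * (N v)%:C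
    & forall u : nat -> V,
        (forall e : R, 0 < e -> \forall m & n \near \oo, N (u m - u n) < e) ->
        exists l, N (u n - l) @[n --> \oo] --> (0 : R)].

HB.mixin Record isCStar (R : realType) A & GRing.Algebra R[i] A := {
  cnorm : A -> R;
  cnorm_banach : banach_norm cnorm;
  cnormM : forall x y, cnorm (x * y) <= cnorm x * cnorm y;
  star : A -> A;
  starK : involutive star;
  starD : forall x y, star (x + y) = star x + star y;
  starZ : forall (k : R[i]) x, star (k *: x) = Num.conj k *: star x;
  starM : forall x y, star (x * y) = star y * star x;
  cnorm_star : forall x, cnorm (star x * x) = cnorm x ^+ 2
}.

#[short(type="cstarType")]
HB.structure Definition CStar (R : realType) :=
  {A of GRing.Algebra R[i] A & isCStar R A}.

Definition cstar_subalg (R : realType) (A : cstarType R) (S : set A) : Prop :=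
  [/\ S 1,
      forall x y, S x -> S y -> S (x + y) /\ S (x * y),
      forall (k : R[i]) x, S x -> S (k *: x),
      forall x, S x -> S (star x)
    & forall (u : nat -> A) l, (forall n, S (u n)) ->
        cnorm (u n - l) @[n --> \oo] --> (0 : R) -> S l].

Definition cstar_generated (R : realType) (A : cstarType R) (X : set A) :
  set A := smallest (@cstar_subalg R A) X.

Definition star_hom (R : realType) (A B : cstarType R) (f : A -> B) : Prop :=
  [/\ linear f, monoid_morphism f & forall x, f (star x) = star (f x)].

Definition unitary (R : realType) (A : cstarType R) (u : A) : Prop :=
  star u * u = 1 /\ u * star u = 1.

Definition Ad (R : realType) (A : cstarType R) (u x : A) : A := u * x * star u.

(* s is the number of space dimensions; coordinate 0 is time. *)
Definition minkowski (R : realType) (s : nat) := 'rV[R]_s.+1.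

Section Minkowski.
Variables (R : realType) (s : nat).
Local Notation M := (minkowski R s).

Definition lorentz_sq (x : M) : R :=
  x 0 0 ^+ 2 - \sum_(i < s) x 0 (lift ord0 i) ^+ 2.

(* The open cone, so that double cones are open. *)
Definition forward (x : M) : Prop := 0 < x 0 0 /\ 0 < lorentz_sq x.

Definition diamond (p q : M) : set M :=
  [set x | forward (x - p) /\ forward (q - x)].

Record double_cone := DoubleCone {
  dc_set :> set M;
  dc_setP : exists p q : M, forward (q - p) /\ dc_set = diamond p q
}.

Definition spacelike_compl (O : set M) : set M :=
  [set x | forall y, O y -> lorentz_sq (x - y) < 0].

Record simplex1 := Simplex1 {
  supp1 : double_cone;
  d0 : double_cone;
  d1 : double_cone;
  simplex1P : d0 `|` d1 `<=` supp1
}.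

Record simplex2 := Simplex2 {
  c_supp : double_cone;
  c_0 : double_cone;
  c_1 : double_cone;
  c_2 : double_cone;
  c_01 : double_cone;
  c_02 : double_cone;
  c_12 : double_cone;
  simplex2P : c_0 `|` c_1 `|` c_2 `<=` c_supp;
  face0P : c_01 `|` c_02 `<=` c_0;
  face1P : c_01 `|` c_12 `<=` c_1;
  face2P : c_02 `|` c_12 `<=` c_2
}.

Definition face0 (c : simplex2) : simplex1 := Simplex1 (@face0P c).
Definition face1 (c : simplex2) : simplex1 := Simplex1 (@face1P c).
Definition face2 (c : simplex2) : simplex1 := Simplex1 (@face2P c).

Lemma forwardE (x : M) :
  forward x <-> 0 < x 0 0 /\ \sum_(i < s) x 0 (lift ord0 i) ^+ 2 < x 0 0 ^+ 2.
Proof. by rewrite /forward /lorentz_sq subr_gt0. Qed.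

Lemma forwardD (x y : M) : forward x -> forward y -> forward (x + y).
Proof.
move=> /forwardE[x0 xs] /forwardE[y0 ys]; apply/forwardE.
rewrite !mxE; split; first exact: addr_gt0.
set X := \sum_i _ in xs; set Y := \sum_i _ in ys.
have -> : \sum_(i < s) (x + y) 0 (lift ord0 i) ^+ 2
   = X + Y + 2 * \sum_(i < s) x 0 (lift ord0 i) * y 0 (lift ord0 i).
  rewrite mulr_sumr -!big_split /=; apply: eq_bigr => i _; rewrite mxE; ring.
set P := \sum_(i < s) _ * _.
have : 0 <= \sum_(i < s)
    (y 0 0 * x 0 (lift ord0 i) - x 0 0 * y 0 (lift ord0 i)) ^+ 2.
  by apply: sumr_ge0 => i _; exact: sqr_ge0.
have -> : \sum_(i < s) (y 0 0 * x 0 (lift ord0 i) - x 0 0 * y 0 (lift ord0 i)) ^+ 2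
   = y 0 0 ^+ 2 * X + x 0 0 ^+ 2 * Y - 2 * (x 0 0 * y 0 0) * P.
  rewrite !mulr_sumr -!big_split /= -sumrB.
  by apply: eq_bigr => i _; ring.
set a := x 0 0 in x0 xs *; set b := y 0 0 in y0 ys * => H.
have ab0 : 0 < a * b by exact: mulr_gt0.
have h1 : b ^+ 2 * X < b ^+ 2 * a ^+ 2 by rewrite ltr_pM2l // exprn_gt0.
have h2 : a ^+ 2 * Y < a ^+ 2 * b ^+ 2 by rewrite ltr_pM2l // exprn_gt0.
have h3 : (a * b) * P < (a * b) * (a * b) by lra.
by move: h3; rewrite ltr_pM2l // => h3; lra.
Qed.

Definition time_axis (t : R) : M := \row_i (if i == 0 then t else 0).

Lemma forward_shift (x : M) :
  exists t0, forall t, t0 <= t -> forward (x + time_axis t).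
Proof.
set S := \sum_(i < s) x 0 (lift ord0 i) ^+ 2.
have S0 : 0 <= S by apply: sumr_ge0 => i _; exact: sqr_ge0.
exists (1 + S - x 0 0) => t tt0; apply/forwardE.
rewrite !mxE eqxx (_ : \sum_(i < s) _ = S); last first.
  by apply: eq_bigr => i _; rewrite !mxE /= addr0.
set w := x 0 0 + t; have w1 : 1 + S <= w by rewrite /w; lra.
split; first lra.
by rewrite expr2; nra.
Qed.

Lemma double_cone_directed (O1 O2 : double_cone) :
  exists O : double_cone, O1 `<=` O /\ O2 `<=` O.
Proof.
case: O1 O2 => D1 [p1 [q1 [_ e1]]] [D2 [p2 [q2 [_ e2]]]] /=.
rewrite {}e1 {}e2.
have [t1 h1] := forward_shift p1; have [t2 h2] := forward_shift p2.
have [t3 h3] := forward_shift (- q1); have [t4 h4] := forward_shift (- q2).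
have [t5 h5] := forward_shift 0.
pose t := `|t1| + `|t2| + `|t3| + `|t4| + `|t5|.
have ht : [/\ t1 <= t, t2 <= t, t3 <= t, t4 <= t & t5 <= t].
  have := (ler_norm t1, ler_norm t2, ler_norm t3, ler_norm t4, ler_norm t5).
  have := (normr_ge0 t1, normr_ge0 t2, normr_ge0 t3, normr_ge0 t4, normr_ge0 t5).
  by move=> [[[[? ?] ?] ?] ?] [[[[? ?] ?] ?] ?]; rewrite /t; split; lra.
case: ht => l1 l2 l3 l4 l5.
have dc : exists p q : M, forward (q - p) /\
    diamond (- time_axis t) (time_axis t) = diamond p q.
  exists (- time_axis t), (time_axis t); split=> //; rewrite opprK.
  by apply: forwardD; rewrite -[time_axis t]add0r; exact: h5.
exists (DoubleCone dc); split => x [/= xp qx]; split.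
- by rewrite -(subrKA p1) opprK; apply: forwardD => //; exact: h1.
- by rewrite -(subrKA q1) addrC; apply: forwardD => //; rewrite addrC; exact: h3.
- by rewrite -(subrKA p2) opprK; apply: forwardD => //; exact: h2.
- by rewrite -(subrKA q2) addrC; apply: forwardD => //; rewrite addrC; exact: h4.
Qed.

Lemma double_cone_inhabited : inhabited double_cone.
Proof.
have [t h] := forward_shift 0.
have dc : exists p q : M, forward (q - p) /\ diamond 0 (time_axis t) = diamond p q.
  by exists 0, (time_axis t); rewrite subr0 -{1}[time_axis t]add0r; split; first exact: h.
by split; exact: (DoubleCone dc).
Qed.

End Minkowski.

(* Double cones are directed, so the local algebras have an inductive limit; a
   net is given by that limit and the images of the local algebras in it. *)
Record net (R : realType) (s : nat) := Net {
  global :> cstarType R;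
  local : double_cone R s -> set global;
  local_subalg : forall O, cstar_subalg (local O);
  isotony : forall O1 O2 : double_cone R s,
    O1 `<=` O2 -> local O1 `<=` local O2;
  local_generate : cstar_generated (\bigcup_O local O) = setT
}.

Arguments local {R s} _ _ _.

Section Nets.
Variables (R : realType) (s : nat).
Implicit Types (A B : net R s) (O : double_cone R s).

Definition local_compl A O : set A :=
  cstar_generated
    (\bigcup_(O1 in [set O1 : double_cone R s | O1 `<=` spacelike_compl O])
      local A O1).
Arguments local_compl : clear implicits.

Definition relative_duality A : Prop :=
  forall O, local A O =
    [set a | forall x, local_compl A O x -> a * x = x * a].

Record net_inclusion A B := NetInclusion {
  incl :> A -> B;
  incl_star_hom : star_hom incl;
  incl_inj : injective incl;
  incl_local : forall O x, local A O x -> local B O (incl x)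
}.

Definition localized A (f : A -> A) O : Prop :=
  forall x, local_compl A O x -> f x = x.

Definition transportable A (f : A -> A) : Prop :=
  forall O, exists2 u : A, unitary u & localized (Ad u \o f) O.

Record lt_endo A := LtEndo {
  lt_fun :> A -> A;
  lt_star_hom : star_hom lt_fun;
  lt_localized : exists O, localized lt_fun O;
  lt_transportable : transportable lt_fun
}.

Definition cocycle A (z : simplex1 R s -> A) : Prop :=
  [/\ forall b, unitary (z b),
      forall b, local A (supp1 b) (z b)
    & forall c, z (face0 c) * z (face2 c) = z (face1 c)].

(* f is the endomorphism determined by z at a: it is prescribed on a dense
   subalgebra. *)
Definition cocycle_field A (z : simplex1 R s -> A) (a : double_cone R s)
    (f : A -> A) : Prop :=
  forall O x b, local A O x -> d0 b = a -> d1 b `<=` spacelike_compl O ->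
    f x = z b * x * star (z b).

Definition canonical_extension A B (i : net_inclusion A B)
    (rho : A -> A) (rho' : B -> B) : Prop :=
  star_hom rho' /\
  exists a (z : simplex1 R s -> A),
    [/\ localized rho a, cocycle z, cocycle_field z a rho
      & cocycle_field (i \o z) a rho'].

End Nets.

Arguments local_compl {R s} _ _ _.
Arguments lt_star_hom {R s A} _.
Arguments lt_localized {R s A} _.
Arguments lt_transportable {R s A} _ _.

(* The tensor products below are strict: associativity and units are equalities
   of objects, along which arrows are transported. *)
Definition hom_cast (R : realType) (T : Type) (hom : T -> T -> lmodType R[i])
    x x' y y' (ex : x = x') (ey : y = y') (f : hom x y) : hom x' y' :=
  ecast z (hom z y') ex (ecast z (hom x z) ey f).

(* Positivity of adj f \o f is not part of the axioms; it is automatic for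
   categories of intertwiners in a C*-algebra. *)
Record tensor_cstar_cat (R : realType) := TensorCStarCat {
  obj : Type;
  hom : obj -> obj -> lmodType R[i];
  hnorm : forall x y, hom x y -> R;
  idm : forall x, hom x x;
  comp : forall x y z, hom y z -> hom x y -> hom x z;
  adj : forall x y, hom x y -> hom y x;
  tob : obj -> obj -> obj;
  tunit : obj;
  thom : forall x y x' y', hom x y -> hom x' y' -> hom (tob x x') (tob y y');

  comp_id_l : forall x y (f : hom x y), comp (idm y) f = f;
  comp_id_r : forall x y (f : hom x y), comp f (idm x) = f;
  compA : forall w x y z (f : hom y z) (g : hom x y) (h : hom w x),
    comp f (comp g h) = comp (comp f g) h;
  comp_linear_l : forall x y z (g : hom x y),
    linear (fun f : hom y z => comp f g);
  comp_linear_r : forall x y z (f : hom y z),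
    linear (fun g : hom x y => comp f g);

  hnorm_banach : forall x y, banach_norm (@hnorm x y);
  hnorm_comp : forall x y z (f : hom y z) (g : hom x y),
    hnorm (comp f g) <= hnorm f * hnorm g;

  adjK : forall x y (f : hom x y), adj (adj f) = f;
  adj_antilinear : forall x y k (f g : hom x y),
    adj (k *: f + g) = Num.conj k *: adj f + adj g;
  adj_comp : forall x y z (f : hom y z) (g : hom x y),
    adj (comp f g) = comp (adj g) (adj f);
  hnorm_adj : forall x y (f : hom x y), hnorm (comp (adj f) f) = hnorm f ^+ 2;

  tobA : forall x y z, tob (tob x y) z = tob x (tob y z);
  tob1o : forall x, tob tunit x = x;
  tobo1 : forall x, tob x tunit = x;
  thom_id : forall x y, thom (idm x) (idm y) = idm (tob x y);
  thom_comp : forall x y z x' y' z' (f : hom y z) (g : hom x y)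
      (f' : hom y' z') (g' : hom x' y'),
    thom (comp f g) (comp f' g') = comp (thom f f') (thom g g');
  thom_adj : forall x y x' y' (f : hom x y) (f' : hom x' y'),
    adj (thom f f') = thom (adj f) (adj f');
  thom_linear_l : forall x y x' y' (f' : hom x' y'),
    linear (fun f : hom x y => thom f f');
  thom_linear_r : forall x y x' y' (f : hom x y),
    linear (fun f' : hom x' y' => thom f f');
  thomA : forall x1 y1 x2 y2 x3 y3
      (f1 : hom x1 y1) (f2 : hom x2 y2) (f3 : hom x3 y3),
    hom_cast (tobA x1 x2 x3) (tobA y1 y2 y3) (thom (thom f1 f2) f3)
      = thom f1 (thom f2 f3);
  thom1f : forall x y (f : hom x y),
    hom_cast (tob1o x) (tob1o y) (thom (idm tunit) f) = f;
  thomf1 : forall x y (f : hom x y),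
    hom_cast (tobo1 x) (tobo1 y) (thom f (idm tunit)) = f
}.

Record tensor_star_functor (R : realType) (C D : tensor_cstar_cat R) :=
  TensorStarFunctor {
  fob :> obj C -> obj D;
  fhom : forall x y, hom x y -> hom (fob x) (fob y);
  fhom_linear : forall x y, linear (@fhom x y);
  fhom_id : forall x, fhom (idm x) = idm (fob x);
  fhom_comp : forall x y z (f : hom y z) (g : hom x y),
    fhom (comp f g) = comp (fhom f) (fhom g);
  fhom_adj : forall x y (f : hom x y), fhom (adj f) = adj (fhom f);
  fob_tunit : fob (tunit C) = tunit D;
  fob_tob : forall x y, fob (tob x y) = tob (fob x) (fob y);
  fhom_thom : forall x y x' y' (f : hom x y) (f' : hom x' y'),
    hom_cast (fob_tob x x') (fob_tob y y') (fhom (thom f f'))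
      = thom (fhom f) (fhom f')
}.

Definition category_inclusion (R : realType) (C D : tensor_cstar_cat R)
    (F : tensor_star_functor C D) : Prop :=
  injective (fob F) /\ forall x y : obj C, injective (@fhom _ _ _ F x y).

Definition intertwines (R : realType) (A : cstarType R) (f g : A -> A) :
  {pred A} := fun T => `[< forall x, T * f x = g x * T >].

Section IntertwinesClosed.
Variables (R : realType) (A : cstarType R) (f g : A -> A).

Lemma intertwines_submod_closed : submod_closed (intertwines f g).
Proof.
split; first by apply/asboolP => x; rewrite mul0r mulr0.
move=> k T U /asboolP hT /asboolP hU; apply/asboolP => x.
by rewrite mulrDl mulrDr -scalerAl -scalerAr hT hU.
Qed.

HB.instance Definition _ :=
  GRing.isSubmodClosed.Build R[i] A (intertwines f g) intertwines_submod_closed.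

End IntertwinesClosed.

Record intertwiner (R : realType) (A : cstarType R) (f g : A -> A) :=
  Intertwiner { arrow :> A; arrowP : arrow \in intertwines f g }.
Arguments arrowP {R A f g} _.

HB.instance Definition _ R A f g := [isSub for @arrow R A f g].
HB.instance Definition _ R A f g := [Choice of @intertwiner R A f g by <:].
HB.instance Definition _ R A f g :=
  [SubChoice_isSubLmodule of @intertwiner R A f g by <:].

Lemma intertwinerP R (A : cstarType R) (f g : A -> A) (T : intertwiner f g) x :
  arrow T * f x = g x * arrow T.
Proof. by have /asboolP := arrowP T => /(_ x). Qed.

Section CStarTheory.
Variables (R : realType) (A : cstarType R).
Implicit Types (x y u v : A) (f g : A -> A).

Lemma cnormZ (k : R[i]) x : (cnorm (k *: x))%:C = `|k| * (cnorm x)%:C.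
Proof. by have [_ _ + _] := @cnorm_banach R A; apply. Qed.

Lemma cnormD x y : cnorm (x + y) <= cnorm x + cnorm y.
Proof. by have [_ + _ _] := @cnorm_banach R A; apply. Qed.

Lemma cnorm0_eq0 x : cnorm x = 0 -> x = 0.
Proof. by have [+ _ _ _] := @cnorm_banach R A; apply. Qed.

Lemma cnorm0 : cnorm (0 : A) = 0.
Proof.
have := cnormZ 0 (0 : A); rewrite scale0r normr0 mul0r => /(congr1 (@complex.Re R)).
by [].
Qed.

Lemma cnormN x : cnorm (- x) = cnorm x.
Proof.
have := cnormZ (-1) x; rewrite scaleN1r normrN normr1 mul1r.
by move=> /(congr1 (@complex.Re R)).
Qed.

Lemma cnorm_ge0 x : 0 <= cnorm x.
Proof. by have := cnormD x (- x); rewrite subrr cnorm0 cnormN; lra. Qed.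

Lemma star1 : star (1 : A) = 1.
Proof. by rewrite -[RHS]starK -[star 1 in RHS]mulr1 starM starK mulr1. Qed.

Lemma unitary1 : unitary (1 : A).
Proof. by rewrite /unitary star1 mulr1. Qed.

Lemma unitaryM u v : unitary u -> unitary v -> unitary (u * v).
Proof.
move=> [u1 u2] [v1 v2]; rewrite /unitary starM; split.
  by rewrite mulrA -(mulrA (star v)) u1 mulr1.
by rewrite mulrA -(mulrA u) v2 mulr1.
Qed.

Lemma star_hom_unitary f u : star_hom f -> unitary u -> unitary (f u).
Proof.
move=> [_ [f1 fM] fs] [u1 u2]; rewrite /unitary -fs -!fM u1 u2 f1.
by split.
Qed.

Lemma star_hom_id : star_hom (@id A).
Proof. by split. Qed.

Lemma star_hom_comp f g : star_hom f -> star_hom g -> star_hom (f \o g).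
Proof.
move=> [fl [f1 fM] fs] [gl [g1 gM] gs]; split.
- by move=> k x y /=; rewrite gl fl.
- by split=> [|x y] /=; rewrite ?g1 ?f1 ?gM ?fM.
- by move=> x /=; rewrite gs fs.
Qed.

Lemma Ad1 x : Ad 1 x = x.
Proof. by rewrite /Ad star1 mulr1 mul1r. Qed.

Lemma intertwines_closed f g (u : nat -> A) l :
  (forall n, u n \in intertwines f g) ->
  cnorm (u n - l) @[n --> \oo] --> (0 : R) -> l \in intertwines f g.
Proof.
move=> hu ul; apply/asboolP => x; apply/eqP; rewrite -subr_eq0; apply/eqP.
apply: cnorm0_eq0; apply/eqP; rewrite eq_le cnorm_ge0 andbT.
apply/ler_addgt0Pr => e e0; rewrite add0r.
pose K := cnorm (f x) + cnorm (g x) + 1.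
have K0 : 0 < K by have := (cnorm_ge0 (f x), cnorm_ge0 (g x)); rewrite /K; move=> [? ?]; lra.
have /cvgrPdist_lt /(_ (e / K)) := ul.
case; first exact: divr_gt0.
move=> N _ /(_ N (leqnn N)) /=; rewrite sub0r normrN ger0_norm ?cnorm_ge0 // => hN.
have -> : l * f x - g x * l = - (u N - l) * f x + g x * (u N - l).
  have /asboolP := hu N => /(_ x) E.
  by rewrite mulNr mulrBl mulrBr E opprB addrA subrK.
apply: (le_trans (cnormD _ _)).
apply: (le_trans (lerD (cnormM _ _) (cnormM _ _))); rewrite cnormN.
move: hN; rewrite ltr_pdivlMr // /K => hN.
by have := cnorm_ge0 (u N - l); nra.
Qed.

End CStarTheory.

Section LtEndo.
Variables (R : realType) (s : nat) (A : net R s).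
Implicit Types (r t : lt_endo A) (O : double_cone R s).

Lemma localizedS (f : A -> A) (O1 O2 : double_cone R s) :
  O1 `<=` O2 -> localized f O1 -> localized f O2.
Proof.
move=> O12 h x hx; apply: h => S [hS sub]; apply: hx; split=> // y [O hO Oy].
apply: sub; exists O => // p /hO hp q /O12; exact: hp.
Qed.

Lemma localized_comp (f g : A -> A) O :
  localized f O -> localized g O -> localized (f \o g) O.
Proof. by move=> hf hg x hx /=; rewrite hg ?hf. Qed.

Lemma id_localized : exists O, localized (@id A) O.
Proof. by have [O] := double_cone_inhabited R s; exists O. Qed.

Lemma id_transportable : transportable (@id A).
Proof. by move=> O; exists 1; [exact: unitary1 | move=> x _ /=; rewrite Ad1]. Qed.

Definition lt_id : lt_endo A :=
  LtEndo (@star_hom_id R A) id_localized id_transportable.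

Lemma comp_localized r t : exists O, localized (r \o t) O.
Proof.
have [O1 h1] := lt_localized r; have [O2 h2] := lt_localized t.
have [O [s1 s2]] := double_cone_directed O1 O2.
by exists O; apply: localized_comp; [exact: localizedS h1|exact: localizedS h2].
Qed.

Lemma comp_transportable r t : transportable (r \o t).
Proof.
move=> O; have [u uu hu] := lt_transportable r O.
have [v vu hv] := lt_transportable t O.
have [_ [_ rM] rs] := lt_star_hom r.
exists (u * r v); first exact/unitaryM/star_hom_unitary/vu/lt_star_hom.
move=> x hx; have vx : Ad v (t x) = x by exact: hv hx.
have ux : Ad u (r x) = x by exact: hu hx.
transitivity (Ad u (r (Ad v (t x)))); last by rewrite vx.
by rewrite /= /Ad !rM rs starM !mulrA.
Qed.

Definition lt_comp r t : lt_endo A :=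
  LtEndo (star_hom_comp (lt_star_hom r) (lt_star_hom t))
    (comp_localized r t) (comp_transportable r t).

Lemma lt_endo_eq r t : (r : A -> A) = t -> r = t.
Proof.
case: r t => f f1 f2 f3 [g g1 g2 g3] /= fg.
by case: _ / fg g1 g2 g3 => *; congr LtEndo; exact: Prop_irrelevance.
Qed.

Lemma lt_compA : forall r1 r2 r3,
  lt_comp (lt_comp r1 r2) r3 = lt_comp r1 (lt_comp r2 r3).
Proof. by move=> *; exact: lt_endo_eq. Qed.

Lemma lt_comp1o r : lt_comp lt_id r = r.
Proof. exact: lt_endo_eq. Qed.

Lemma lt_compo1 r : lt_comp r lt_id = r.
Proof. exact: lt_endo_eq. Qed.

End LtEndo.

Section Intertwiners.
Variables (R : realType) (s : nat) (A : net R s).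
Implicit Types (r t : lt_endo A).

Lemma intertwiner_id_subproof r : (1 : A) \in intertwines r r.
Proof. by apply/asboolP => x; rewrite mul1r mulr1. Qed.

Definition intertwiner_id r : intertwiner r r :=
  Intertwiner (intertwiner_id_subproof r).

Lemma intertwiner_comp_subproof r1 r2 r3
    (S : intertwiner r2 r3) (T : intertwiner r1 r2) :
  arrow S * arrow T \in intertwines r1 r3.
Proof.
by apply/asboolP => x; rewrite -mulrA intertwinerP mulrA intertwinerP mulrA.
Qed.

Definition intertwiner_comp r1 r2 r3 (S : intertwiner r2 r3)
    (T : intertwiner r1 r2) : intertwiner r1 r3 :=
  Intertwiner (intertwiner_comp_subproof S T).

Lemma intertwiner_adj_subproof r t (T : intertwiner r t) :
  star (arrow T) \in intertwines t r.
Proof.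
apply/asboolP => x; rewrite -[x]starK.
have [_ _ ->] := lt_star_hom t; have [_ _ ->] := lt_star_hom r.
by rewrite -!starM intertwinerP.
Qed.

Definition intertwiner_adj r t (T : intertwiner r t) : intertwiner t r :=
  Intertwiner (intertwiner_adj_subproof T).

Lemma intertwiner_tens_subproof r t r' t'
    (T : intertwiner r t) (T' : intertwiner r' t') :
  arrow T * r (arrow T') \in intertwines (lt_comp r r') (lt_comp t t').
Proof.
apply/asboolP => x /=; have [_ [_ rM] _] := lt_star_hom r.
by rewrite -mulrA -rM (intertwinerP T') rM mulrA intertwinerP -mulrA.
Qed.

Definition intertwiner_tens r t r' t'
    (T : intertwiner r t) (T' : intertwiner r' t') :
    intertwiner (lt_comp r r') (lt_comp t t') :=
  Intertwiner (intertwiner_tens_subproof T T').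

Definition lt_hom r t : lmodType R[i] := intertwiner r t.

Definition lt_norm r t (T : lt_hom r t) : R := cnorm (arrow T).

Lemma lt_hom_cast r r' t t' (er : r = r') (et : t = t') (T : lt_hom r t) :
  arrow (hom_cast er et T) = arrow T.
Proof. by case: _ / er; case: _ / et. Qed.

Lemma intertwiner_eq r t (S T : intertwiner r t) : arrow S = arrow T -> S = T.
Proof. exact: val_inj. Qed.

Lemma lt_norm_banach r t : banach_norm (@lt_norm r t).
Proof.
split.
- by move=> v /cnorm0_eq0 v0; exact: intertwiner_eq.
- by move=> v w; exact: cnormD.
- by move=> k v; exact: cnormZ.
- move=> u cu; have [_ _ _ /(_ (fun n => arrow (u n)))] :=
    @cnorm_banach R A.
  case=> [|l ul]; first exact: cu.
  have hl : l \in intertwines r t by apply: intertwines_closed ul => n; exact: arrowP.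
  by exists (Intertwiner hl).
Qed.

Definition Tt : tensor_cstar_cat R.
Proof.
refine (@TensorCStarCat R (lt_endo A) lt_hom lt_norm intertwiner_id
  intertwiner_comp intertwiner_adj (@lt_comp R s A) (lt_id A) intertwiner_tens
  _ _ _ _ _ lt_norm_banach _ _ _ _ _ (@lt_compA R s A) (@lt_comp1o R s A)
  (@lt_compo1 R s A)
  _ _ _ _ _ _ _ _).
- by move=> r t T; apply: intertwiner_eq; rewrite /= mul1r.
- by move=> r t T; apply: intertwiner_eq; rewrite /= mulr1.
- by move=> *; apply: intertwiner_eq; rewrite /= mulrA.
- by move=> r1 r2 r3 S k T T'; apply: intertwiner_eq; rewrite /= mulrDl -scalerAl.
- by move=> r1 r2 r3 S k T T'; apply: intertwiner_eq; rewrite /= mulrDr -scalerAr.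
- by move=> *; exact: cnormM.
- by move=> *; apply: intertwiner_eq; rewrite /= starK.
- by move=> *; apply: intertwiner_eq; rewrite /= starD starZ.
- by move=> *; apply: intertwiner_eq; rewrite /= starM.
- by move=> *; exact: cnorm_star.
- move=> r t; apply: intertwiner_eq; rewrite /= mul1r.
  by have [_ [-> _] _] := lt_star_hom r.
- move=> x y z x' y' z' f g f' g'; apply: intertwiner_eq => /=.
  have [_ [_ rM] _] := lt_star_hom x.
  by rewrite rM !mulrA -[in RHS](mulrA (arrow f)) -intertwinerP !mulrA.
- move=> x y x' y' f f'; apply: intertwiner_eq => /=.
  have [_ _ ys] := lt_star_hom y.
  by rewrite intertwinerP starM ys.
- move=> x y x' y' f' k f g; apply: intertwiner_eq => /=.
  by rewrite mulrDl -scalerAl.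
- move=> x y x' y' f k f' g'; apply: intertwiner_eq => /=.
  have [xl _ _] := lt_star_hom x.
  by rewrite xl mulrDr -scalerAr.
- move=> x1 y1 x2 y2 x3 y3 f1 f2 f3; apply: intertwiner_eq.
  rewrite lt_hom_cast /=.
  by have [_ [_ rM] _] := lt_star_hom x1; rewrite rM mulrA.
- move=> x y f; apply: intertwiner_eq; rewrite lt_hom_cast /=.
  by rewrite mul1r.
- move=> x y f; apply: intertwiner_eq; rewrite lt_hom_cast /=.
  by have [_ [-> _] _] := lt_star_hom x; rewrite mulr1.
Defined.
End Intertwiners.

(* Main.v *)
Require Import Defs.
From mathcomp Require Import all_boot all_order all_algebra.
From mathcomp Require Import ring lra.
From mathcomp Require Import complex.
From mathcomp Require Import boolp classical_sets reals topology normedtype.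
From mathcomp Require Import sequences.

Set Implicit Arguments.
Unset Strict Implicit.
Unset Printing Implicit Defensive.

Import Order.TTheory GRing.Theory Num.Theory.
Import numFieldNormedType.Exports.
Local Open Scope classical_set_scope.
Local Open Scope complex_scope.
Local Open Scope ring_scope.

(** On the algebra of the spacelike complement of any double cone [O], a
    localized transportable endomorphism [rho] of A is inner: some unitary [u] of
    A satisfies [rho x = u * x * star u] for all [x] in A(O'); say that [u]
    implements [rho] at [O]. Its extension to B is the endomorphism [f] that
    [i u] implements at [O] for every such pair ([extends]). Formulated in this
    way the extension refers to no cocycle, and it agrees with the one obtained
    from a cocycle field ([canonical_extensionP]).

    Relative duality enters through one remark ([incl_commutant]): an element of
    A commuting with A(O') lies in A(O), so its image lies in B(O) and commutes
    with B(O'). Two unitaries that implement [rho] at [O] differ by such an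
    element, and so does an arrow of A from [rho] to [sigma] once it is conjugated
    with implementing unitaries at [O]. Hence arrows of A remain arrows between
    the extensions ([extends_intertwiner]); for the arrow [1] this is uniqueness
    of the extension. Compatibility with composition follows, because
    [rho v * u] implements [rho \o sigma] when [u] implements [rho] and [v]
    implements [sigma], and [f] restricts to [rho] on A.

    Existence ([extension_exists]) takes the pointwise limit of the inner
    automorphisms given by [i u] at double cones that escape to spacelike
    infinity. On a local algebra B(O) this sequence is eventually constant: the
    unitaries at two double cones of O' act alike on B(O), because O' is
    connected through chains of double cones, and at each link of the chain the
    two unitaries differ by an element localized in O'. This connectedness
    ([spacelike_compl_connected]) is where more than two spacetime dimensions
    are needed.

    Identities between star homomorphisms are known only on local algebras. They
    pass to the whole algebra because star homomorphisms of C*-algebras are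
    automatically contractive ([star_hom_le]). The reason for this is elementary:
    a selfadjoint element of norm less than [1] is the real part of a unitary,
    and star homomorphisms preserve unitaries. *)

(** * Norm convergence in a C*-algebra *)

Section NormConvergence.
Variables (R : realType) (A : cstarType R).
Implicit Types (x y l m : A) (u v : nat -> A).

Definition converges u l : Prop := cnorm (u n - l) @[n --> \oo] --> (0 : R).

Lemma converges_le u l (g : nat -> R) :
  (\forall n \near \oo, cnorm (u n - l) <= g n) ->
  g n @[n --> \oo] --> (0 : R) -> converges u l.
Proof.
move=> ug g0; apply: squeeze_cvgr (cvg_cst 0) g0.
by apply: filterS ug => n; rewrite cnorm_ge0.
Qed.

Lemma convergesP u l : converges u l <->
  forall e : R, 0 < e -> \forall n \near \oo, cnorm (u n - l) < e.
Proof.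
split=> [/cvgr0Pnorm_lt ul e e0|ul].
  by apply: filterS (ul e e0) => n; rewrite ger0_norm ?cnorm_ge0.
apply/cvgr0Pnorm_lt => e e0.
by apply: filterS (ul e e0) => n; rewrite ger0_norm ?cnorm_ge0.
Qed.

Lemma converges_near_cst u l : (\forall n \near \oo, u n = l) -> converges u l.
Proof.
move=> ul; apply: (@converges_le _ _ (fun=> 0)); last exact: cvg_cst.
by apply: filterS ul => n ->; rewrite subrr cnorm0.
Qed.

Lemma converges_unique u l m : converges u l -> converges u m -> l = m.
Proof.
move=> /convergesP ul /convergesP um.
apply/eqP; rewrite -subr_eq0; apply/eqP; apply: cnorm0_eq0.
apply/eqP; rewrite eq_le cnorm_ge0 andbT.
apply/ler_addgt0Pr => e e0; rewrite add0r.
have e2 : 0 < e / 2 by rewrite divr_gt0.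
have [n [h1 h2]] := filter_ex (filterI (ul _ e2) (um _ e2)).
have -> : l - m = - (u n - l) + (u n - m) by rewrite opprB addrA subrK.
by have := cnormD (- (u n - l)) (u n - m); rewrite cnormN; lra.
Qed.

Lemma convergesD u v l m :
  converges u l -> converges v m -> converges (fun n => u n + v n) (l + m).
Proof.
move=> ul vm.
apply: (@converges_le _ _ (fun n => cnorm (u n - l) + cnorm (v n - m))).
  by apply: nearW => n; rewrite opprD addrACA; exact: cnormD.
by rewrite -[0]addr0; exact: cvgD.
Qed.

Lemma convergesM u v l m :
  converges u l -> converges v m -> converges (fun n => u n * v n) (l * m).
Proof.
move=> ul vm.
apply: (@converges_le _ _ (fun n => cnorm (u n - l) * cnorm (v n - m)
  + (cnorm (u n - l) * cnorm m + cnorm l * cnorm (v n - m)))).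
  apply: nearW => n.
  have -> : u n * v n - l * m
      = (u n - l) * (v n - m) + ((u n - l) * m + l * (v n - m)).
    rewrite -{1}(subrK l (u n)) -{1}(subrK m (v n)) mulrDl !mulrDr.
    by rewrite !addrA addrK.
  apply: (le_trans (cnormD _ _)); apply: lerD; first exact: cnormM.
  by apply: (le_trans (cnormD _ _)); apply: lerD; exact: cnormM.
have z : 0 * 0 + (0 * cnorm m + cnorm l * 0) = 0 :> R.
  by rewrite !mulr0 !mul0r !addr0.
rewrite -[X in _ --> X]z; apply: cvgD; first exact: cvgM.
by apply: cvgD; apply: cvgM => //; exact: cvg_cst.
Qed.

Lemma convergesZ (k : R[i]) u l :
  converges u l -> converges (fun n => k *: u n) (k *: l).
Proof.
move=> ul; have := @convergesM (fun=> k *: 1) u (k *: 1) l.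
rewrite -scalerAl mul1r => h; have := h _ ul.
rewrite (_ : (fun n => _ * _) = fun n => k *: u n); last first.
  by apply: funext => n; rewrite -scalerAl mul1r.
by apply; apply: converges_near_cst; exact: nearW.
Qed.

Lemma cnorm_starE x : cnorm (star x) = cnorm x.
Proof.
have h y : cnorm y <= cnorm (star y).
  have := cnorm_star y; have := cnormM (star y) y => le1 E.
  have [->|y0] := eqVneq (cnorm y) 0; first exact: cnorm_ge0.
  have yp : 0 < cnorm y by rewrite lt_def y0 cnorm_ge0.
  by move: le1; rewrite E expr2 ler_pM2r.
by apply/eqP; rewrite eq_le h -{2}[x]starK h.
Qed.

Lemma starN x : star (- x) = - star x.
Proof. by rewrite -scaleN1r starZ rmorphN rmorph1 scaleN1r. Qed.

Lemma converges_star u l :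
  converges u l -> converges (fun n => star (u n)) (star l).
Proof.
move=> ul; apply: (@converges_le _ _ (fun n => cnorm (u n - l))) => //.
by apply: nearW => n; rewrite -starN -starD cnorm_starE.
Qed.

End NormConvergence.

(** * Star homomorphisms are contractive *)

Section Contraction.
Variable R : realType.
Implicit Types A B : cstarType R.

Lemma cnormZr A (r : R) (x : A) : 0 <= r -> cnorm (r%:C *: x) = r * cnorm x.
Proof.
move=> r0; have := cnormZ r%:C x.
rewrite normc_def /= expr0n addr0 sqrtr_sqr ger0_norm // -rmorphM.
by move=> /(congr1 (@complex.Re R)).
Qed.

Lemma cnorm1_le1 A : cnorm (1 : A) <= 1.
Proof.
have := cnorm_star (1 : A); rewrite star1 mul1r expr2.
have [->|n0] := eqVneq (cnorm (1 : A)) 0; first by rewrite ler01.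
have np : 0 < cnorm (1 : A) by rewrite lt_def n0 cnorm_ge0.
by move=> E; rewrite -(ler_pM2l np) -E mulr1.
Qed.

Lemma unitary_cnorm_le1 A (u : A) : unitary u -> cnorm u <= 1.
Proof.
move=> [u1 _]; have := cnorm1_le1 A.
by rewrite -u1 cnorm_star expr_le1 // cnorm_ge0.
Qed.

Lemma starB A (x y : A) : star (x - y) = star x - star y.
Proof. by rewrite starD starN. Qed.

Lemma star0 A : star (0 : A) = 0.
Proof. by apply: (addrI (star 0)); rewrite -starD !addr0. Qed.

Lemma star_scaler A (r : R) (x : A) : star (r%:C *: x) = r%:C *: star x.
Proof. by rewrite starZ conj_Creal // complex_real. Qed.

Lemma contraction_converges A (y : nat -> A) (q c : R) :
    0 <= q -> q < 1 -> (forall n, cnorm (y n) <= c) -> y 0%N = 0 ->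
    (forall m n, cnorm (y m.+1 - y n.+1) <= q * cnorm (y m - y n)) ->
  exists l, converges y l.
Proof.
move=> q0 q1 yc y0 step.
have c0 : 0 <= c := le_trans (cnorm_ge0 _) (yc 0%N).
have tail n k : cnorm (y (n + k)%N - y n) <= q ^+ n * c.
  elim: n => [|n IHn]; first by rewrite y0 subr0 mul1r.
  rewrite addSn exprS -mulrA.
  by apply: (le_trans (step _ _)); rewrite ler_wpM2l.
have tail2 N m n : (N <= m)%N -> (N <= n)%N ->
    cnorm (y m - y n) <= q ^+ N * (c + c).
  move=> /subnKC <- /subnKC <-.
  rewrite -(subrKA (y N)) mulrDr; apply: (le_trans (cnormD _ _)).
  by apply: lerD; [|rewrite -cnormN opprB]; exact: tail.
have [_ _ _] := @cnorm_banach R A; apply => e e0.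
have : q ^+ n * (c + c) @[n --> \oo] --> (0 : R).
  rewrite -[X in _ --> X](mul0r (c + c)); apply: cvgM; last exact: cvg_cst.
  by apply: cvg_expr; rewrite ger0_norm.
move=> /cvgr0Pnorm_lt /(_ _ e0) [N _ hN].
exists ([set n | (N <= n)%N], [set n | (N <= n)%N]).
  by split; exact: nbhs_infty_ge.
move=> [m n] /= [Nm Nn]; apply: (le_lt_trans (tail2 _ _ _ Nm Nn)).
have := hN N (leqnn N); rewrite /= ger0_norm //.
by rewrite mulr_ge0 ?exprn_ge0 ?addr_ge0.
Qed.

(** With these properties [a + 'i *: s] is a unitary whose real part is [a].
    Writing [s = 1 - y], the equation [s * s = 1 - a * a] reads
    [y = (a * a + y * y) / 2]; the right-hand side maps the ball of radius
    [cnorm (a * a)] into itself and contracts it, so iteration from [0] finds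
    [y], which is a limit of polynomials in [a]. *)
Lemma selfadjoint_complement A (a : A) : star a = a -> cnorm a < 1 ->
  exists s, [/\ star s = s, a * s = s * a & a * a + s * s = 1].
Proof.
move=> sa a1; pose q := cnorm (a * a).
have q0 : 0 <= q := cnorm_ge0 _.
have q1 : q < 1.
  apply: (le_lt_trans (cnormM _ _)); have := cnorm_ge0 a; nra.
pose h : R[i] := (2^-1 : R)%:C.
have hh (x : A) : h *: x + h *: x = x.
  have half2 : 2^-1 + 2^-1 = 1 :> R by lra.
  by rewrite -scalerDl /h -rmorphD half2 rmorph1 scale1r.
have nh (x : A) : cnorm (h *: x) = 2^-1 * cnorm x.
  by apply: cnormZr; rewrite invr_ge0.
pose F (y : A) := h *: (a * a + y * y).
pose y n := iter n F 0.
have yq n : cnorm (y n) <= q.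
  elim: n => [|n IHn]; first by rewrite /= cnorm0.
  rewrite /= /F nh; have := cnormD (a * a) (y n * y n).
  have := cnormM (y n) (y n).
  rewrite -/q; have := cnorm_ge0 (y n); set N := cnorm (y n) in IHn *; nra.
have ystar n : star (y n) = y n.
  elim: n => [|n IHn]; first by rewrite /= star0.
  by rewrite /= /F star_scaler starD !starM sa IHn.
have ycomm n : a * y n = y n * a.
  elim: n => [|n IHn]; first by rewrite mulr0 mul0r.
  rewrite /= /F -/(y n) -scalerAr -scalerAl mulrDr mulrDl (mulrA a a a).
  by rewrite (mulrA a (y n)) IHn -(mulrA (y n)) IHn !mulrA.
have step m n : cnorm (y m.+1 - y n.+1) <= q * cnorm (y m - y n).
  rewrite /= /F -scalerBr nh opprD addrACA subrr add0r.
  have -> : y m * y m - y n * y n = y m * (y m - y n) + (y m - y n) * y n.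
    by rewrite mulrBr mulrBl addrA subrK.
  have := cnormD (y m * (y m - y n)) ((y m - y n) * y n).
  have := cnormM (y m) (y m - y n); have := cnormM (y m - y n) (y n).
  have := cnorm_ge0 (y m - y n); have := yq m; have := yq n.
  set M := cnorm (y m); set N := cnorm (y n); set D := cnorm (y m - y n).
  move=> Nq Mq D0 h1 h2 h3.
  have h4 : D * N <= q * D by rewrite mulrC ler_wpM2r.
  have h5 : M * D <= q * D by rewrite ler_wpM2r.
  lra.
have [l yl] := contraction_converges q0 q1 yq (erefl _) step.
have sl : star l = l.
  apply: (converges_unique (u := y)) => //.
  by have := converges_star yl; rewrite (_ : (fun n => _) = y) //;
    exact: funext.
have cl : a * l = l * a.
  have ca : converges (fun=> a) a by apply: converges_near_cst; exact: nearW.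
  apply: (converges_unique (u := fun n => a * y n)); first exact: convergesM.
  rewrite (funext ycomm); exact: convergesM.
have fixl : l = F l.
  apply: (converges_unique (u := fun n => y n.+1)).
    by move: yl; rewrite /converges -(cvg_shiftS (fun n => cnorm (y n - l))).
  rewrite /F; apply: convergesZ; apply: convergesD; last exact: convergesM.
  by apply: converges_near_cst; exact: nearW.
have l2 : l + l = a * a + l * l by rewrite {1 2}fixl /F hh.
exists (1 - l); split.
- by rewrite starB star1 sl.
- by rewrite mulrBr mulrBl cl mulr1 mul1r.
- have -> : (1 - l) * (1 - l) = 1 - (l + l) + l * l.
    by rewrite mulrBl mul1r mulrBr mulr1 opprB opprD !addrA addrAC.
  by rewrite l2 opprD !addrA subrK addrAC subrr add0r.
Qed.

Section StarHom.
Variables (A B : cstarType R) (f : A -> B).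
Hypothesis hf : star_hom f.

Lemma star_homD x y : f (x + y) = f x + f y.
Proof. by have [fl _ _] := hf; have := fl 1 x y; rewrite !scale1r. Qed.

Lemma star_homZ (k : R[i]) x : f (k *: x) = k *: f x.
Proof.
have f0 : f 0 = 0 by apply: (addrI (f 0)); rewrite -star_homD !addr0.
by have [fl _ _] := hf; have := fl k x 0; rewrite !addr0 f0 addr0.
Qed.

Lemma star_homB x y : f (x - y) = f x - f y.
Proof. by rewrite star_homD -scaleN1r star_homZ scaleN1r. Qed.

Lemma star_homM x y : f (x * y) = f x * f y.
Proof. by have [_ [_ ->] _] := hf. Qed.

Lemma star_hom1 : f 1 = 1.
Proof. by have [_ [-> _] _] := hf. Qed.

Lemma star_homS x : f (star x) = star (f x).
Proof. by have [_ _ ->] := hf. Qed.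

End StarHom.

Lemma star_hom_image_unitary A B (f : A -> B) u :
  star_hom f -> unitary u -> unitary (f u).
Proof.
by move=> hf [u1 u2]; split;
  rewrite -(star_homS hf) -(star_homM hf) ?u1 ?u2 (star_hom1 hf).
Qed.

(** A selfadjoint [a] with [cnorm a < 1] is the mean of a unitary and its
    adjoint, hence so is [f a], whose norm is therefore at most [1]. Scaling
    gives the selfadjoint case, and the C*-identity reduces [x] to
    [star x * x]. *)
Lemma star_hom_le A B (f : A -> B) x : star_hom f -> cnorm (f x) <= cnorm x.
Proof.
move=> hf.
have small (a : A) : star a = a -> cnorm a < 1 -> cnorm (f a) <= 1.
  move=> sa /(selfadjoint_complement sa)[s [ss cs E]].
  have ii : 'i * 'i = -1 :> R[i] by rewrite -expr2 sqrCi.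
  set t := 'i *: s.
  have su : star (a + t) = a - t.
    by rewrite starD sa starZ ss conjCi scaleNr.
  have E' : a * a - t * t = 1.
    by rewrite -scalerAl -scalerAr scalerA ii scaleN1r opprK.
  have c' : a * t = t * a by rewrite -scalerAl -scalerAr cs.
  have uu : unitary (a + t).
    split; rewrite su -E'.
      by rewrite mulrBl !mulrDr c' opprD addrA addrK.
    by rewrite mulrDl !mulrBr c' addrA subrK.
  have [f1 f2] : unitary (f (a + t)) /\ unitary (f (a - t)).
    split; first exact: star_hom_image_unitary.
    apply: star_hom_image_unitary => //; rewrite -su.
    by case: uu => u1 u2; split; rewrite starK.
  have -> : f a = (2^-1 : R)%:C *: (f (a + t) + f (a - t)).
    have half2 : 2^-1 + 2^-1 = 1 :> R by lra.
    rewrite -(star_homD hf) addrACA subrr addr0 (star_homD hf).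
    by rewrite scalerDr -scalerDl -rmorphD half2 rmorph1 scale1r.
  rewrite cnormZr ?invr_ge0 //.
  have := cnormD (f (a + t)) (f (a - t)).
  by have := unitary_cnorm_le1 f1; have := unitary_cnorm_le1 f2; lra.
have sad (a : A) : star a = a -> cnorm (f a) <= cnorm a.
  move=> sa; apply/ler_addgt0Pr => e e0.
  have c0 : 0 < cnorm a + e by rewrite ltr_wpDl ?cnorm_ge0.
  have := small ((cnorm a + e)^-1%:C *: a).
  rewrite star_scaler sa (star_homZ hf) !cnormZr ?invr_ge0 ?(ltW c0) //.
  rewrite !(mulrC (_^-1)) ltr_pdivrMr // ler_pdivrMr // !mul1r ltrDl.
  exact.
have : cnorm (f x) ^+ 2 <= cnorm x ^+ 2.
  rewrite -!cnorm_star -!(star_homS hf) -!(star_homM hf).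
  by apply: sad; rewrite starM starK.
by rewrite ler_sqr ?nnegrE ?cnorm_ge0.
Qed.

End Contraction.

(** * Generated subalgebras and limits of homomorphisms *)

Section Generation.
Variable R : realType.
Implicit Types A B : cstarType R.

Lemma star_hom_converges A B (f : A -> B) (u : nat -> A) l :
  star_hom f -> converges u l -> converges (f \o u) (f l).
Proof.
move=> hf ul; apply: (converges_le _ ul); apply: nearW => n /=.
by rewrite -(star_homB hf); exact: star_hom_le.
Qed.

Lemma Ad_star_hom A (u : A) : unitary u -> star_hom (Ad u).
Proof.
move=> [u1 u2]; rewrite /Ad; split=> [k x y|| x].
- by rewrite mulrDr mulrDl -scalerAr -scalerAl.
- split=> [|x y]; first by rewrite mulr1.
  by rewrite !mulrA -(mulrA _ (star u) u) u1 mulr1.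
- by rewrite !starM starK mulrA.
Qed.

Lemma comp_star_hom A B (C : cstarType R) (f : B -> C) (g : A -> B) :
  star_hom f -> star_hom g -> star_hom (f \o g).
Proof.
move=> hf hg; split=> [k x y||x] /=.
- by rewrite (star_homD hg) (star_homZ hg) (star_homD hf) (star_homZ hf).
- split=> [|x y] /=; first by rewrite (star_hom1 hg) (star_hom1 hf).
  by rewrite (star_homM hg) (star_homM hf).
- by rewrite (star_homS hg) (star_homS hf).
Qed.

Lemma generated_ind A (X S : set A) :
  cstar_subalg S -> X `<=` S -> cstar_generated X `<=` S.
Proof. by move=> hS XS x; apply; split. Qed.

Lemma sub_generated A (X : set A) : X `<=` cstar_generated X.
Proof. by move=> x Xx S [_ XS]; exact: XS. Qed.

Lemma generatedS A (X Y : set A) :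
  X `<=` Y -> cstar_generated X `<=` cstar_generated Y.
Proof. by move=> XY x hx S [hS YS]; apply: hx; split=> // y /XY /YS. Qed.

Lemma generated_subalg A (X : set A) : cstar_subalg (cstar_generated X).
Proof.
split.
- by move=> S [[S1 _ _ _ _] _].
- move=> x y hx hy; split=> S hS; have [[_ h _ _ _] _] := hS;
    by have [] := h _ _ (hx _ hS) (hy _ hS).
- by move=> k x hx S hS; have [[_ _ h _ _] _] := hS; apply: h; exact: hx.
- by move=> x hx S hS; have [[_ _ _ h _] _] := hS; apply: h; exact: hx.
- move=> u l hu ul S hS; have [[_ _ _ _ h] _] := hS.
  by apply: h ul => n; exact: hu.
Qed.

Lemma preimage_subalg A B (f : A -> B) (S : set B) :
  star_hom f -> cstar_subalg S -> cstar_subalg (f @^-1` S).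
Proof.
move=> hf [S1 SDM SZ Ss Sl]; split.
- by rewrite /preimage /= (star_hom1 hf).
- move=> x y fx fy; rewrite /preimage /= (star_homD hf) (star_homM hf).
  exact: SDM.
- by move=> k x fx; rewrite /preimage /= (star_homZ hf); exact: SZ.
- by move=> x fx; rewrite /preimage /= (star_homS hf); exact: Ss.
- move=> u l fu ul; apply: (Sl (f \o u)) => //; exact: star_hom_converges.
Qed.

Lemma generated_image A B (f : A -> B) (X : set A) (Y : set B) :
  star_hom f -> (forall x, X x -> Y (f x)) ->
  forall x, cstar_generated X x -> cstar_generated Y (f x).
Proof.
move=> hf XY; apply: (generated_ind (S := f @^-1` cstar_generated Y)).
  exact: preimage_subalg hf (generated_subalg Y).
by move=> x Xx; apply: sub_generated; exact: XY.
Qed.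

(** The condition on [star x] is what makes this set a star subalgebra, as [T]
    alone need not intertwine [f] and [g] on adjoints. *)
Lemma intertwining_subalg A B (f g : A -> B) (T : B) :
  star_hom f -> star_hom g ->
  cstar_subalg [set x | T * f x = g x * T /\ T * f (star x) = g (star x) * T].
Proof.
move=> hf hg.
have lim (u : nat -> A) l : (forall n, T * f (u n) = g (u n) * T) ->
    converges u l -> T * f l = g l * T.
  move=> Tu ul; have cT : converges (fun=> T) T.
    by apply: converges_near_cst; exact: nearW.
  apply: (converges_unique (u := fun n => T * f (u n))).
    by apply: convergesM => //; exact: star_hom_converges ul.
  rewrite (funext Tu); apply: convergesM => //; exact: star_hom_converges ul.
have mul x y : T * f x = g x * T -> T * f y = g y * T ->
    T * f (x * y) = g (x * y) * T.
  by move=> hx hy; rewrite (star_homM hf) (star_homM hg) mulrA hx -!mulrA hy.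
split => /=.
- by rewrite star1 !(star_hom1 hf) !(star_hom1 hg) mulr1 mul1r.
- move=> x y [x1 x2] [y1 y2]; split; last by split; rewrite ?starM; exact: mul.
  by rewrite starD !(star_homD hf) !(star_homD hg) !mulrDr !mulrDl x1 x2 y1 y2.
- move=> k x [x1 x2]; rewrite starZ !(star_homZ hf) !(star_homZ hg).
  by rewrite -!scalerAr -!scalerAl x1 x2.
- by move=> x [x1 x2]; rewrite starK.
- move=> u l hu ul; split; first by apply: lim ul => n; have [] := hu n.
  by apply: (lim (star \o u)) (converges_star ul) => n; have [] := hu n.
Qed.

Lemma intertwining_ind A B (f g : A -> B) (T : B) (X : set A) :
  star_hom f -> star_hom g -> (forall x, X x -> X (star x)) ->
  (forall x, X x -> T * f x = g x * T) ->
  forall x, cstar_generated X x -> T * f x = g x * T.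
Proof.
move=> hf hg Xs XT x /(generated_ind (intertwining_subalg T hf hg)) [] // y Xy /=.
by split; apply: XT => //; exact: Xs.
Qed.

Lemma star_hom_eq_ind A B (f g : A -> B) (X : set A) :
  star_hom f -> star_hom g -> (forall x, X x -> f x = g x) ->
  forall x, cstar_generated X x -> f x = g x.
Proof.
move=> hf hg Xfg x /(generated_ind (intertwining_subalg 1 hf hg)) [].
  move=> y /Xfg fgy /=.
  by rewrite !mul1r !mulr1 !(star_homS hf) !(star_homS hg) fgy.
by rewrite mul1r mulr1.
Qed.

(** The points of convergence form a star subalgebra, and contractivity, being
    uniform in [n], makes it closed. *)
Lemma star_hom_pointwise_limit A B (f : nat -> A -> B) (X : set A) :
    (forall n, star_hom (f n)) -> cstar_generated X = setT ->
    (forall x, X x -> exists l, converges (f^~ x) l) ->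
  exists2 g, star_hom g & forall x, converges (f^~ x) (g x).
Proof.
move=> hf genX convX.
have conv x : exists l, converges (f^~ x) l.
  have : cstar_generated X x by rewrite genX.
  apply: (generated_ind (S := [set x | exists l, converges (f^~ x) l])) => //.
  split => /=.
  - exists 1; apply: converges_near_cst; apply: nearW => n.
    exact: star_hom1 (hf n).
  - move=> y z [l yl] [m zm]; split; [exists (l + m)|exists (l * m)].
      have := convergesD yl zm; congr converges; apply: funext => n.
      by rewrite (star_homD (hf n)).
    have := convergesM yl zm; congr converges; apply: funext => n.
    by rewrite (star_homM (hf n)).
  - move=> k y [l yl]; exists (k *: l); have := convergesZ k yl.
    by congr converges; apply: funext => n; rewrite (star_homZ (hf n)).
  - move=> y [l yl]; exists (star l); have := converges_star yl.
    by congr converges; apply: funext => n; rewrite (star_homS (hf n)).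
  - move=> u l hu /convergesP ul.
    have [_ _ _] := @cnorm_banach R B; apply => e e0.
    have e4 : 0 < e / 4 by rewrite divr_gt0.
    have [k ukl] := filter_ex (ul _ e4).
    have [m /convergesP /(_ _ e4) um] := hu k.
    exists ([set n | cnorm (f n (u k) - m) < e / 4],
            [set n | cnorm (f n (u k) - m) < e / 4]) => // -[p q] /= [hp hq].
    have -> : f p l - f q l = - f p (u k - l) + (f p (u k) - m)
        + (f q (u k - l) - (f q (u k) - m)).
      rewrite (star_homB (hf p)) (star_homB (hf q)).
      set a := f p l; set b := f p (u k); set c := f q (u k); set d := f q l.
      have -> : - (b - a) + (b - m) = a - m by rewrite opprB subrKA.
      have -> : c - d - (c - m) = m - d by rewrite opprB addrC subrKA.
      by rewrite subrKA.
    have := star_hom_le (u k - l) (hf p); have := star_hom_le (u k - l) (hf q).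
    have := cnormD (- f p (u k - l) + (f p (u k) - m))
      (f q (u k - l) - (f q (u k) - m)).
    have := cnormD (- f p (u k - l)) (f p (u k) - m).
    have := cnormD (f q (u k - l)) (- (f q (u k) - m)).
    rewrite !cnormN; lra.
have [g hg] := choice conv.
exists g => //; split.
- move=> k x y.
  apply: (converges_unique (u := fun n => f n (k *: x + y))); first exact: hg.
  have := convergesD (convergesZ k (hg x)) (hg y).
  congr converges; apply: funext => n.
  by rewrite (star_homD (hf n)) (star_homZ (hf n)).
- split=> [|x y].
    apply: (converges_unique (hg 1)).
    by apply: converges_near_cst; apply: nearW => n; exact: star_hom1 (hf n).
  apply: (converges_unique (hg _)).
  have := convergesM (hg x) (hg y).
  by congr converges; apply: funext => n; rewrite (star_homM (hf n)).
- move=> x; apply: (converges_unique (hg _)).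
  have := converges_star (hg x).
  by congr converges; apply: funext => n; rewrite (star_homS (hf n)).
Qed.

End Generation.

(** * Connectedness of spacelike complements *)

Section Geometry.
Variables (R : realType) (s : nat).
Local Notation M := (minkowski R s).
Implicit Types (x y p q : M) (m n w : 'I_s -> R) (O D : double_cone R s).

Definition unit_vector n : Prop := \sum_(i < s) n i ^+ 2 = 1.

Lemma axis_unit_vector (c : R) (j : 'I_s) : c ^+ 2 = 1 ->
  unit_vector (fun i => if i == j then c else 0).
Proof.
move=> c1; rewrite /unit_vector (bigD1 j) //= eqxx c1 big1 ?addr0 // => i.
by move=> /negbTE ->; rewrite expr0n.
Qed.

(** The Minkowski product with the lightlike vector [(1, n)]. *)
Definition null_form n x : R := x 0 0 - \sum_(i < s) n i * x 0 (lift ord0 i).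

Definition null_vector n : M :=
  \row_j (if unlift ord0 j is Some i then n i else 1).

Lemma null_formD n x y : null_form n (x + y) = null_form n x + null_form n y.
Proof.
rewrite /null_form mxE [RHS]addrACA -opprD -big_split /=.
by congr (_ - _); apply: eq_bigr => i _; rewrite mxE mulrDr.
Qed.

Lemma null_formZ n (c : R) x : null_form n (c *: x) = c * null_form n x.
Proof.
rewrite /null_form mxE mulrBr mulr_sumr.
by congr (_ - _); apply: eq_bigr => i _; rewrite mxE mulrCA.
Qed.

Lemma null_formN n x : null_form n (- x) = - null_form n x.
Proof. by rewrite -scaleN1r null_formZ mulN1r. Qed.

Lemma null_formB n x y : null_form n (x - y) = null_form n x - null_form n y.
Proof. by rewrite null_formD null_formN. Qed.

Lemma null_vector0 n : null_vector n 0 0 = 1.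
Proof. by rewrite mxE unlift_none. Qed.

Lemma null_vectorS n i : null_vector n 0 (lift ord0 i) = n i.
Proof. by rewrite mxE liftK. Qed.

Lemma null_form_null_vector n :
  unit_vector n -> null_form n (null_vector n) = 0.
Proof.
move=> n1; rewrite /null_form null_vector0.
rewrite (eq_bigr (fun i => n i ^+ 2)) ?n1 ?subrr // => i _.
by rewrite null_vectorS.
Qed.

Lemma time_axis0 (t : R) : time_axis s t 0 0 = t.
Proof. by rewrite mxE. Qed.

Lemma null_form_time n (t : R) : null_form n (time_axis s t) = t.
Proof.
rewrite /null_form time_axis0 big1 ?subr0 // => i _.
by rewrite mxE /= mulr0.
Qed.

Lemma cauchy_schwarz_unit n (x : 'I_s -> R) : unit_vector n ->
  (\sum_(i < s) n i * x i) ^+ 2 <= \sum_(i < s) x i ^+ 2.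
Proof.
move=> n1; set c := \sum_i n i * x i.
have : 0 <= \sum_(i < s) (x i - c * n i) ^+ 2.
  by apply: sumr_ge0 => i _; exact: sqr_ge0.
have -> : \sum_(i < s) (x i - c * n i) ^+ 2
    = \sum_(i < s) x i ^+ 2 - 2 * c * c + c ^+ 2 * \sum_(i < s) n i ^+ 2.
  have -> : 2 * c * c = \sum_(i < s) 2 * c * (n i * x i) by rewrite -mulr_sumr.
  rewrite [c ^+ 2 * _]mulr_sumr -sumrB -big_split /=.
  by apply: eq_bigr => i _; ring.
rewrite [\sum_(i < s) n i ^+ 2]n1; lra.
Qed.

Lemma forward_null_form n x : unit_vector n -> forward x -> 0 < null_form n x.
Proof.
move=> n1 /forwardE[x0 xs].
have := cauchy_schwarz_unit (fun i => x 0 (lift ord0 i)) n1.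
rewrite /null_form; set c := \sum_i n i * _; nra.
Qed.

(** The null functionals cut out the closed forward cone; the one in the
    direction of the spatial part of [x], or in any direction if that part
    vanishes, takes its least value on [x]. *)
Lemma null_form_separation x : (0 < s)%N -> (0 <= x 0 0 -> lorentz_sq x < 0) ->
  exists2 n, unit_vector n & null_form n x < 0.
Proof.
move=> s0 hx; pose X := \sum_(i < s) x 0 (lift ord0 i) ^+ 2.
have X0 : 0 <= X by apply: sumr_ge0 => i _; exact: sqr_ge0.
have [XE|Xn] := eqVneq X 0.
  have xi i : x 0 (lift ord0 i) = 0.
    have /psumr_eq0P h : X = 0 by [].
    apply/eqP; rewrite -sqrf_eq0; apply/eqP; apply: h => // j _.
    exact: sqr_ge0.
  exists (fun i => if i == Ordinal s0 then 1 else 0).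
    by apply: axis_unit_vector; rewrite expr1n.
  rewrite /null_form big1 => [|i _]; last by rewrite xi mulr0.
  rewrite subr0 ltNge; apply/negP => /hx.
  by rewrite /lorentz_sq -/X XE subr0 ltNge sqr_ge0.
have Xp : 0 < X by rewrite lt_def Xn.
pose r := Num.sqrt X; have r0 : 0 < r by rewrite sqrtr_gt0.
have r2 : r ^+ 2 = X by rewrite sqr_sqrtr.
exists (fun i => x 0 (lift ord0 i) / r).
  rewrite /unit_vector (eq_bigr (fun i => x 0 (lift ord0 i) ^+ 2 / r ^+ 2)).
    by rewrite -mulr_suml -/X r2 divff.
  by move=> i _; rewrite expr_div_n.
have -> : null_form (fun i => x 0 (lift ord0 i) / r) x = x 0 0 - r.
  rewrite /null_form (eq_bigr (fun i => x 0 (lift ord0 i) ^+ 2 / r)).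
    by rewrite -mulr_suml -/X -r2 expr2 mulfK // gt_eqF.
  by move=> i _; rewrite mulrAC expr2.
rewrite subr_lt0; have [x0|x0] := lerP 0 (x 0 0); last by lra.
have := hx x0; rewrite /lorentz_sq -/X -r2; nra.
Qed.

Lemma spacelike_null_form m n x : unit_vector m -> unit_vector n ->
  null_form m x < 0 -> null_form n (- x) < 0 -> lorentz_sq x < 0.
Proof.
move=> m1 n1; rewrite null_formN oppr_lt0 /lorentz_sq /null_form.
have := cauchy_schwarz_unit (fun i => x 0 (lift ord0 i)) m1.
have := cauchy_schwarz_unit (fun i => x 0 (lift ord0 i)) n1.
set X := \sum_i x _ _ ^+ 2; set c := \sum_i n i * _; set d := \sum_i m i * _.
by move=> cX dX xd cx; have [x0|x0] := lerP 0 (x 0 0); nra.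
Qed.

(** The square of [x + L *: null_vector n] grows like [2 * L * null_form n x],
    since the light ray itself does not contribute. *)
Lemma forward_null_shift n x : unit_vector n -> 0 < null_form n x ->
  \forall L \near +oo, forward (x + L *: null_vector n).
Proof.
move=> n1; rewrite /null_form; set c := \sum_i _ => xc.
pose X := \sum_(i < s) x 0 (lift ord0 i) ^+ 2.
have X0 : 0 <= X by apply: sumr_ge0 => i _; exact: sqr_ge0.
have := nbhs_pinfty_ge (num_real (`|x 0 0| + X / (x 0 0 - c) + 1)).
apply: filterS => L hL; apply/forwardE.
have -> : \sum_(i < s) (x + L *: null_vector n) 0 (lift ord0 i) ^+ 2
    = X + 2 * L * c + L ^+ 2.
  rewrite -[L ^+ 2]mulr1 -[X in _ = _ + _ * X]n1 !mulr_sumr -!big_split /=.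
  by apply: eq_bigr => i _; rewrite mxE [X in _ + X]mxE null_vectorS; ring.
rewrite mxE [X in _ + X]mxE null_vector0 mulr1.
have := ler_norm (- x 0 0); rewrite normrN => h1.
have h2 := normr_ge0 (x 0 0).
have h3 : 0 <= X / (x 0 0 - c) by rewrite divr_ge0 // ltW.
split; first by lra.
have h4 : X < 2 * L * (x 0 0 - c).
  have : X / (x 0 0 - c) < 2 * L by lra.
  by rewrite ltr_pdivrMr.
by have := sqr_ge0 (x 0 0); lra.
Qed.

Lemma forward_shift_by x p : forward p ->
  \forall L \near +oo, forward (x + L *: p).
Proof.
move=> /forwardE[p0 ps].
set P := \sum_(i < s) _ in ps.
pose X := \sum_(i < s) x 0 (lift ord0 i) ^+ 2.
pose S := \sum_(i < s) x 0 (lift ord0 i) * p 0 (lift ord0 i).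
pose a := p 0 0 ^+ 2 - P; pose b := 2 * (x 0 0 * p 0 0 - S).
pose c := x 0 0 ^+ 2 - X.
have a0 : 0 < a by rewrite subr_gt0.
have ge1 := nbhs_pinfty_ge (num_real (1 : R)).
have gta := nbhs_pinfty_gt (num_real ((`|b| + `|c|) / a)).
have gtp := nbhs_pinfty_gt (num_real (`|x 0 0| / p 0 0)).
apply: filterS3 ge1 gta gtp => L L1; rewrite !ltr_pdivrMr // => La Lp.
apply/forwardE; rewrite mxE [X in _ + X]mxE.
have h1 := ler_norm (- x 0 0); rewrite normrN in h1; split; first by lra.
have -> : \sum_(i < s) (x + L *: p) 0 (lift ord0 i) ^+ 2
    = X + 2 * L * S + L ^+ 2 * P.
  rewrite [2 * L * S]mulr_sumr [L ^+ 2 * P]mulr_sumr -!big_split /=.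
  by apply: eq_bigr => i _; rewrite mxE [X in _ + X]mxE; ring.
have h2 := ler_norm (- b); have h3 := ler_norm (- c); rewrite !normrN in h2 h3.
have h4 := normr_ge0 b; have h5 := normr_ge0 c.
suff : 0 < L * (L * a + b) + c by rewrite /a /b /c; lra.
have h6 : `|c| < L * a + b by lra.
have h7 : L * a + b <= L * (L * a + b).
  by rewrite ler_peMl // (le_trans h5) // ltW.
lra.
Qed.

Lemma forwardZ (c : R) x : 0 < c -> forward x -> forward (c *: x).
Proof.
move=> c0 /forwardE[x0 xs]; apply/forwardE; rewrite mxE; split.
  exact: mulr_gt0.
rewrite (eq_bigr (fun i => c ^+ 2 * x 0 (lift ord0 i) ^+ 2)) => [|i _].
  by rewrite -mulr_sumr exprMn ltr_pM2l // exprn_gt0.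
by rewrite mxE exprMn.
Qed.

Lemma forward_time_axis (t : R) : 0 < t -> forward (time_axis s t).
Proof.
move=> t0; apply/forwardE; rewrite time_axis0 big1 ?exprn_gt0 // => i _.
by rewrite mxE /= expr0n.
Qed.

Lemma lorentz_sqN x : lorentz_sq (- x) = lorentz_sq x.
Proof.
rewrite /lorentz_sq mxE sqrrN; congr (_ - _).
by apply: eq_bigr => i _; rewrite mxE sqrrN.
Qed.

Lemma spacelike_sym (X Y : set M) :
  X `<=` spacelike_compl Y -> Y `<=` spacelike_compl X.
Proof. by move=> XY y Yy x Xx; rewrite -lorentz_sqN opprB; exact: XY. Qed.

Lemma diamondS p q p' q' :
  p = p' \/ forward (p - p') -> q = q' \/ forward (q' - q) ->
  diamond p q `<=` diamond p' q'.
Proof.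
move=> hp hq x [px xq]; split.
  by case: hp => [<- //|hp]; rewrite -(subrKA p); exact: forwardD.
by case: hq => [<- //|hq]; rewrite -(subrKA q); exact: forwardD.
Qed.

(** The first functional keeps [diamond p1 q1] out of the causal future of
    [diamond p q], the second one out of its causal past. *)
Lemma diamond_spacelike m n p q p1 q1 : unit_vector m -> unit_vector n ->
  null_form m (q1 - p) <= 0 -> null_form n (q - p1) <= 0 ->
  diamond p1 q1 `<=` spacelike_compl (diamond p q).
Proof.
move=> m1 n1; rewrite !null_formB => hm hn x [p1x xq1] y [py yq].
have := forward_null_form m1 xq1; have := forward_null_form m1 py.
have := forward_null_form n1 p1x; have := forward_null_form n1 yq.
rewrite !null_formB => *.
by apply: (spacelike_null_form m1 n1); rewrite ?opprB null_formB; lra.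
Qed.

(** Otherwise [x - p] is in the closed forward cone; moving [x] towards
    [q1] and [p], by much less, towards [q] gives causally related points of the
    two cones. *)
Lemma past_apex_separation p q p1 q1 x : (0 < s)%N -> forward (q - p) ->
    diamond p1 q1 `<=` spacelike_compl (diamond p q) -> diamond p1 q1 x ->
  exists2 n, unit_vector n & null_form n (x - p) < 0.
Proof.
move=> s0 pq sep [p1x xq1]; apply: contrapT => nsep.
have nf n : unit_vector n -> 0 <= null_form n (x - p).
  by move=> n1; rewrite leNgt; apply/negP => lt0; apply: nsep; exists n.
have half0 : 0 < 2^-1 :> R by rewrite invr_gt0.
have hx : forward (2^-1 *: (q1 - x)) by exact: forwardZ.
have [L [hL L1]] := filter_ex (filterI
  (forward_shift_by (- (q - p)) hx) (nbhs_pinfty_gt (num_real (1 : R)))).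
have L0 : 0 < L by lra.
have eL : 0 < L^-1 < 1 by rewrite invr_gt0 L0 invf_lt1.
case/andP: eL => e0 e1.
(* [e] is so small that the step from [x] dominates the step from [p]. *)
set e := L^-1 in e0 e1.
pose x' := x + 2^-1 *: (q1 - x); pose y := p + e *: (q - p).
have Dx' : diamond p1 q1 x'.
  split; first by rewrite /x' addrAC; exact: forwardD.
  have -> : q1 - x' = 2^-1 *: (q1 - x).
    by apply/rowP => j; rewrite !mxE; lra.
  exact: forwardZ.
have Oy : diamond p q y.
  split; first by rewrite /y addrC addKr; exact: forwardZ.
  have -> : q - y = (1 - e) *: (q - p).
    by apply/rowP => j; rewrite !mxE; ring.
  by apply: forwardZ => //; lra.
have xy : forward (x' - y - (x - p)).
  have -> : x' - y - (x - p) = e *: (- (q - p) + L *: (2^-1 *: (q1 - x))).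
    rewrite scalerDr scalerA mulVf ?gt_eqF // scale1r.
    by apply/rowP => j; rewrite !mxE; ring.
  exact: forwardZ.
have [n n1 lt0] := null_form_separation s0 (fun=> sep _ Dx' _ Oy).
have := forward_null_form n1 xy; rewrite null_formB; have := nf _ n1; lra.
Qed.

Lemma diamondN p q x : diamond (- q) (- p) (- x) <-> diamond p q x.
Proof. by rewrite /diamond /= !opprK ![- _ + _]addrC; split=> -[]. Qed.

Lemma future_apex_separation p q p1 q1 x : (0 < s)%N -> forward (q - p) ->
    diamond p1 q1 `<=` spacelike_compl (diamond p q) -> diamond p1 q1 x ->
  exists2 n, unit_vector n & null_form n (q - x) < 0.
Proof.
move=> s0 pq sep /diamondN Dx.
have [||n n1] :=
  @past_apex_separation (- q) (- p) (- q1) (- p1) (- x) s0 _ _ Dx.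
- by rewrite opprK addrC.
- move=> y; rewrite -{1}[y]opprK => /diamondN Dy z.
  rewrite -{1}[z]opprK => /diamondN Oz.
  by rewrite -lorentz_sqN opprD; exact: sep.
- by rewrite opprK addrC; exists n.
Qed.

Definition cone p q (pq : forward (q - p)) : double_cone R s :=
  DoubleCone (ex_intro _ p (ex_intro _ q (conj pq erefl))).

Lemma null_vectorD_forward m n : unit_vector m -> unit_vector n -> m <> n ->
  forward (null_vector m + null_vector n).
Proof.
move=> m1 n1 mn; apply/forwardE; rewrite mxE !null_vector0; split; first by lra.
have D0 : 0 < \sum_(i < s) (m i - n i) ^+ 2.
  rewrite lt_def sumr_ge0 ?andbT => [|i _]; last exact: sqr_ge0.
  apply/eqP => /psumr_eq0P h; apply: mn; apply: funext => i.
  apply/eqP; rewrite -subr_eq0 -sqrf_eq0; apply/eqP; apply: h => // j _.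
  exact: sqr_ge0.
have : \sum_(i < s) (null_vector m + null_vector n) 0 (lift ord0 i) ^+ 2
    + \sum_(i < s) (m i - n i) ^+ 2
  = 2 * \sum_(i < s) m i ^+ 2 + 2 * \sum_(i < s) n i ^+ 2.
  rewrite !mulr_sumr -!big_split /=; apply: eq_bigr => i _.
  by rewrite mxE !null_vectorS; ring.
rewrite m1 n1; lra.
Qed.

Lemma exists_third_direction m n : (1 < s)%N ->
  exists w, [/\ unit_vector w, w <> m & w <> n].
Proof.
move=> s1; pose i0 := Ordinal (ltnW s1); pose i1 := Ordinal s1.
pose e (c : R) (j : 'I_s) i : R := if i == j then c else 0.
have d01 : e 1 i0 <> e (-1) i0.
  by move=> /(congr1 (fun f => f i0)); rewrite /e eqxx; lra.
have d02 : e 1 i0 <> e 1 i1.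
  by move=> /(congr1 (fun f => f i0)); rewrite /e eqxx /=; lra.
have d12 : e (-1) i0 <> e 1 i1.
  by move=> /(congr1 (fun f => f i0)); rewrite /e eqxx /=; lra.
have u0 : unit_vector (e 1 i0) by apply: axis_unit_vector; rewrite expr1n.
have u1 : unit_vector (e (-1) i0).
  by apply: axis_unit_vector; rewrite sqrrN expr1n.
have u2 : unit_vector (e 1 i1) by apply: axis_unit_vector; rewrite expr1n.
have [E0|N0] := pselect (e 1 i0 = m \/ e 1 i0 = n); last first.
  by exists (e 1 i0); split=> // E; apply: N0; [left|right].
have [E1|N1] := pselect (e (-1) i0 = m \/ e (-1) i0 = n); last first.
  by exists (e (-1) i0); split=> // E; apply: N1; [left|right].
by exists (e 1 i1); split=> // E; case: E0 E1 => [E0|E0] [E1|E1]; congruence.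
Qed.

(** For [L] large these cones exhaust a wedge, an unbounded region spacelike to
    [diamond p q]: [n] is the spatial direction in which the upper apex escapes
    along a light ray, [m] that of the lower one. *)
Definition wedge_cone p q m n (L : R) : set M :=
  diamond (q - L *: null_vector m) (p + L *: null_vector n).

Lemma wedge_cone_spacelike p q m n (L : R) : unit_vector m -> unit_vector n ->
  wedge_cone p q m n L `<=` spacelike_compl (diamond p q).
Proof.
move=> m1 n1; apply: (diamond_spacelike n1 m1).
  by rewrite addrAC subrr add0r null_formZ null_form_null_vector // mulr0.
by rewrite opprB addrCA subrr addr0 null_formZ null_form_null_vector // mulr0.
Qed.

(** The gap left by the unit time translation makes room for the small cones
    at the apices. *)
Lemma wedge_cone_gap p q m n : unit_vector m -> unit_vector n -> m <> n ->
  \forall L \near +oo,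
    forward (p - q - time_axis s 1 + L *: (null_vector m + null_vector n)).
Proof. by move=> m1 n1 mn; apply/forward_shift_by/null_vectorD_forward. Qed.

Lemma upper_apex_forward x : forward (x - (x - time_axis s (1 : R))).
Proof. by rewrite opprB addrC subrK; apply: forward_time_axis. Qed.

Lemma lower_apex_forward x : forward (x + time_axis s (1 : R) - x).
Proof. by rewrite addrAC subrr add0r; apply: forward_time_axis. Qed.

Definition upper_apex_cone p n (L : R) : double_cone R s :=
  cone (upper_apex_forward (p + L *: null_vector n)).

Definition lower_apex_cone q m (L : R) : double_cone R s :=
  cone (lower_apex_forward (q - L *: null_vector m)).

Lemma upper_apex_cone_sub p q m n (L : R) :
  forward (p - q - time_axis s 1 + L *: (null_vector m + null_vector n)) ->
  upper_apex_cone p n L `<=` wedge_cone p q m n L.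
Proof.
move=> gap; apply: diamondS; last by left.
right; congr forward: gap.
by apply/rowP => j; rewrite !mxE; ring.
Qed.

Lemma lower_apex_cone_sub p q m n (L : R) :
  forward (p - q - time_axis s 1 + L *: (null_vector m + null_vector n)) ->
  lower_apex_cone q m L `<=` wedge_cone p q m n L.
Proof.
move=> gap; apply: diamondS; first by left.
right; congr forward: gap.
by apply/rowP => j; rewrite !mxE; ring.
Qed.

Lemma wedge_cone_forward p q m n (L : R) :
  forward (p - q - time_axis s 1 + L *: (null_vector m + null_vector n)) ->
  forward (p + L *: null_vector n - (q - L *: null_vector m)).
Proof.
move=> gap; have := forwardD gap (forward_time_axis (ltr01 : 0 < (1 : R))).
congr forward; by apply/rowP => j; rewrite !mxE; ring.
Qed.

(** Shrinking [D] moves its apices off the light cones through [p] and [q], so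
    that both separating functionals become strictly negative; then the growing
    cones absorb the smaller one. *)
Lemma enter_wedge p q D : (0 < s)%N -> forward (q - p) ->
    D `<=` spacelike_compl (diamond p q) ->
  exists D' m n, [/\ D' `<=` D, unit_vector m, unit_vector n, m <> n &
    \forall L \near +oo, (D' : set M) `<=` wedge_cone p q m n L].
Proof.
case: D => D [p1 [q1 [pq1 DE]]] s0 pq /=; rewrite {D}DE => sep.
pose p2 := p1 + 4^-1 *: (q1 - p1); pose q2 := p1 + 2^-1 *: (q1 - p1).
have pos (c : R) : 0 < c -> forward (c *: (q1 - p1)).
  by move=> c0; exact: forwardZ.
have pp : forward (p2 - p1) by rewrite /p2 addrAC subrr add0r; apply: pos; lra.
have qq : forward (q1 - q2).
  have -> : q1 - q2 = 2^-1 *: (q1 - p1) by apply/rowP => j; rewrite !mxE; lra.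
  by apply: pos; lra.
have pq2 : forward (q2 - p2).
  have -> : q2 - p2 = 4^-1 *: (q1 - p1) by apply/rowP => j; rewrite !mxE; lra.
  by apply: pos; lra.
have D2 : diamond p1 q1 p2.
  by split=> //; rewrite -(subrKA q2); exact: forwardD.
have D3 : diamond p1 q1 q2.
  by split=> //; rewrite -(subrKA p2); exact: forwardD.
have [n n1 hn] := past_apex_separation s0 pq sep D3.
have [m m1 hm] := future_apex_separation s0 pq sep D2.
exists (cone pq2), m, n; split=> //.
- by apply: diamondS; right.
- move=> mn; rewrite mn in hm.
  have := forward_null_form n1 pq; have := forward_null_form n1 pq2.
  by move: hm hn; rewrite !null_formB; lra.
have hn' : 0 < null_form n (p - q2) by rewrite -opprB null_formN oppr_gt0.
have hm' : 0 < null_form m (p2 - q) by rewrite -opprB null_formN oppr_gt0.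
apply: filterS2 (forward_null_shift n1 hn') (forward_null_shift m1 hm').
move=> L hq hp.
apply: diamondS; right.
  by rewrite opprB addrA addrAC.
by rewrite addrAC.
Qed.

(** Quantifying over the transitive relations [r] says that [D1] and [D2] are
    joined by a chain of double cones, neighbours lying in a common double cone
    spacelike to [O]. The wedges that [D1] and [D2] enter, with directions
    [m1, n1] and [m2, n2], are linked through those with directions [w, n1] and
    [w, n2], since wedges sharing a direction share cones at that apex. For the
    middle wedges to contain cones, [w] must differ from [n1] and [n2]; such a
    [w] exists because the unit sphere of a space of dimension at least two has
    more than two points. *)
Theorem spacelike_compl_connected O D1 D2
    (r : double_cone R s -> double_cone R s -> Prop) : (1 < s)%N ->
    (forall a b c, r a b -> r b c -> r a c) ->
    (forall a b c : double_cone R s,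
      a `<=` c -> b `<=` c -> c `<=` spacelike_compl O -> r a b) ->
  D1 `<=` spacelike_compl O -> D2 `<=` spacelike_compl O -> r D1 D2.
Proof.
case: O => O [p [q [pq OE]]] s1 trans /=; rewrite {O}OE => link sep1 sep2.
have s0 := ltnW s1.
have [D1' [m1 [n1 [sub1 m11 n11 mn1 ev1]]]] := enter_wedge s0 pq sep1.
have [D2' [m2 [n2 [sub2 m21 n21 mn2 ev2]]]] := enter_wedge s0 pq sep2.
have [w [w1 wn1 wn2]] := exists_third_direction n1 n2 s1.
have [L [[h1 h2] [[g1 g2] [g3 g4]]]] := filter_ex (filterI (filterI ev1 ev2)
  (filterI
    (filterI (wedge_cone_gap p q m11 n11 mn1) (wedge_cone_gap p q w1 n11 wn1))
    (filterI (wedge_cone_gap p q w1 n21 wn2) (wedge_cone_gap p q m21 n21 mn2)))).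
pose wedge m n gap : double_cone R s :=
  cone (@wedge_cone_forward p q m n L gap).
have sep m n gap : unit_vector m -> unit_vector n ->
    wedge m n gap `<=` spacelike_compl (diamond p q).
  exact: wedge_cone_spacelike.
apply: (trans _ D1'); first exact: (link _ _ D1).
apply: (trans _ (upper_apex_cone p n1 L)).
  apply: (link _ _ (wedge _ _ g1)) => //; last exact: sep.
  exact: upper_apex_cone_sub.
apply: (trans _ (lower_apex_cone q w L)).
  by apply: (link _ _ (wedge _ _ g2)); [exact: upper_apex_cone_sub|
    exact: lower_apex_cone_sub|exact: sep].
apply: (trans _ (upper_apex_cone p n2 L)).
  by apply: (link _ _ (wedge _ _ g3)); [exact: lower_apex_cone_sub|
    exact: upper_apex_cone_sub|exact: sep].
apply: (trans _ D2'); last exact: (link _ _ D2).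
apply: (link _ _ (wedge _ _ g4)) => //; last exact: sep.
exact: upper_apex_cone_sub.
Qed.

(** Translates going off in a spatial direction. *)
Lemma spacelike_escape : (0 < s)%N ->
  exists D : nat -> double_cone R s,
    forall O, \forall N \near \oo, D N `<=` spacelike_compl O.
Proof.
move=> s0; pose n (i : 'I_s) : R := if i == Ordinal s0 then 1 else 0.
have n1 : unit_vector n by apply: axis_unit_vector; rewrite expr1n.
pose n' i := - n i.
have n'1 : unit_vector n'.
  by rewrite /unit_vector -[RHS]n1; apply: eq_bigr => i _; rewrite sqrrN.
pose u := null_vector n - time_axis s 1.
have un : null_form n u = -1.
  by rewrite null_formB null_form_null_vector // null_form_time sub0r.
have un' : null_form n' u = 1.
  rewrite null_formB null_form_time /null_form null_vector0.
  rewrite (eq_bigr (fun i => - n i ^+ 2)) => [|i _]; last first.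
    by rewrite null_vectorS /n'; ring.
  by rewrite sumrN n1; lra.
exists (fun N => cone (lower_apex_forward (N%:R *: u))).
case=> O [p [q [pq OE]]] /=; rewrite {O}OE.
have h1 := nbhs_infty_ger (1 - null_form n p).
have h2 := nbhs_infty_ger (null_form n' q).
apply: filterS2 h1 h2 => N h1 h2; apply: (diamond_spacelike n1 n'1).
  rewrite null_formB null_formD null_formZ un null_form_time; lra.
rewrite null_formB null_formZ un'; lra.
Qed.

End Geometry.

(** * Commutants and implementing unitaries *)

Section Nets.
Variables (R : realType) (s : nat).
Implicit Types (A B : net R s) (O D : double_cone R s).

Lemma local_compl_ind A O (B : cstarType R) (f g : A -> B) :
  star_hom f -> star_hom g ->
  (forall O1, O1 `<=` spacelike_compl O ->
    forall x, local A O1 x -> f x = g x) ->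
  forall x, local_compl A O x -> f x = g x.
Proof.
by move=> hf hg fg; apply: star_hom_eq_ind => // x [O1 /fg h] /h.
Qed.

Lemma local_sub_compl A O D :
  D `<=` spacelike_compl O -> local A O `<=` local_compl A D.
Proof.
move=> DO x Ox; apply: sub_generated; exists O => //; exact: spacelike_sym.
Qed.

Lemma local_in_compl A : (1 < s)%N ->
  forall O, exists D, local A O `<=` local_compl A D.
Proof.
move=> s1 O; have [D esc] := spacelike_escape R (ltnW s1).
by have [N hN] := filter_ex (esc O); exists (D N); exact: local_sub_compl.
Qed.

Lemma local_compl_anti A O D : O `<=` D -> local_compl A D `<=` local_compl A O.
Proof.
move=> OD; apply: generatedS; apply: bigcup_subset => O1 h x /h hx y Oy.
by apply: hx; exact: OD.
Qed.

Lemma local_compl_incl A B (i : net_inclusion A B) O x :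
  local_compl A O x -> local_compl B O (i x).
Proof.
apply: generated_image; first exact: incl_star_hom.
by move=> y [O1 h Oy]; exists O1 => //; exact: incl_local.
Qed.

(** Relative duality of A turns a commutation relation into localization, which
    the inclusion preserves; relative duality of B turns it back. *)
Lemma incl_commutant A B (i : net_inclusion A B) O (T : A) :
  relative_duality A -> relative_duality B ->
  (forall x, local_compl A O x -> T * x = x * T) ->
  forall y, local_compl B O y -> i T * y = y * i T.
Proof.
move=> dA dB hT; have : local B O (i T) by apply: incl_local; rewrite dA.
by rewrite dB.
Qed.

Definition implements A (u : A) (f : A -> A) O : Prop :=
  unitary u /\ forall x, local_compl A O x -> f x = Ad u x.

Lemma unitary_star A (u : A) : unitary u -> unitary (star u).
Proof. by case=> u1 u2; split; rewrite starK. Qed.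

Lemma AdK A (u x : A) : unitary u -> Ad (star u) (Ad u x) = x.
Proof.
by case=> u1 _; rewrite /Ad starK !mulrA u1 mul1r -mulrA u1 mulr1.
Qed.

Lemma AdM A (u v x : A) : Ad (u * v) x = Ad u (Ad v x).
Proof. by rewrite /Ad starM !mulrA. Qed.

Lemma Ad_commute A (u x : A) : unitary u -> (Ad u x = x <-> u * x = x * u).
Proof.
case=> u1 u2; rewrite /Ad; split=> [E|->]; last by rewrite -mulrA u2 mulr1.
by rewrite -[in RHS]E -mulrA u1 mulr1.
Qed.

Lemma Ad_eq A (u v x : A) : unitary u -> unitary v ->
  (Ad v x = Ad u x <-> star u * v * x = x * (star u * v)).
Proof.
move=> uu uv; have us := unitary_star uu.
rewrite -Ad_commute; last exact: unitaryM.
rewrite AdM; split=> [->|E]; first exact: AdK.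
by rewrite -[X in Ad u X]E -{1}[u]starK AdK.
Qed.

Lemma transportable_implements A (f : A -> A) O :
  transportable f -> exists u, implements u f O.
Proof.
move=> /(_ O)[u uu hu]; exists (star u); split; first exact: unitary_star.
by move=> x hx; rewrite -[in RHS](hu x hx) /= AdK.
Qed.

Lemma implements_localized A (u : A) f O :
  implements u f O -> localized (Ad (star u) \o f) O.
Proof. by move=> [uu hu] x hx /=; rewrite hu // AdK. Qed.

Lemma localized_implements A (f : A -> A) O :
  localized f O <-> implements 1 f O.
Proof.
split=> [hf|[_ hf] x hx]; last by rewrite hf // Ad1.
by split=> [|x hx]; [exact: unitary1|rewrite Ad1 hf].
Qed.

End Nets.

(** * Extension of transportable endomorphisms *)

Section Extension.
Variables (R : realType) (s : nat) (A B : net R s) (i : net_inclusion A B).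
Hypotheses (s1 : (1 < s)%N) (dA : relative_duality A) (dB : relative_duality B).
Implicit Types (O D : double_cone R s) (rho sigma : A -> A) (f g : B -> B).

Let hi : star_hom i := incl_star_hom i.

(** The canonical extension characterized without a choice of cocycle, which is
    what makes uniqueness and compatibility with composition direct. *)
Definition extends rho f : Prop :=
  star_hom f /\ forall O u, implements u rho O -> implements (i u) f O.

(** Thus [extends] needs to be tested on one implementing unitary at each double
    cone only. *)
Lemma implements_incl rho f O u v :
  implements u rho O -> implements (i u) f O -> implements v rho O ->
  implements (i v) f O.
Proof.
move=> [uu hu] [iuu hf] [uv hv]; have iuv := star_hom_image_unitary hi uv.
split=> // y hy; rewrite hf //; apply/esym; apply/(Ad_eq _ iuu iuv).
rewrite -(star_homS hi) -(star_homM hi); apply: incl_commutant hy => // x hx.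
by apply/(Ad_eq _ uu uv); rewrite -hu ?hv.
Qed.

(** At a double cone [D], with [u] and [v] implementing [rho] and [sigma], the
    relation for [T] says that [star v * T * u] commutes with A(D'); then its
    image commutes with B(D'), which is the relation for [i T] there. *)
Lemma extends_intertwiner rho sigma f g (T : A) :
    transportable rho -> transportable sigma ->
    extends rho f -> extends sigma g ->
    (forall x, T * rho x = sigma x * T) ->
  forall y, i T * f y = g y * i T.
Proof.
move=> tr ts [hf ef] [hg eg] hT y.
have : cstar_generated (\bigcup_O local B O) y by rewrite local_generate.
apply: intertwining_ind => // {}y [O _ Oy].
  by exists O => //; have [_ _ _ h _] := @local_subalg _ _ B O; exact: h.
have [D /(_ _ Oy) Dy] := local_in_compl B s1 O.
have [u hu] := transportable_implements D tr.
have [v hv] := transportable_implements D ts.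
have [[iu1 iu2] fD] := ef _ _ hu; have [[iv1 iv2] gD] := eg _ _ hv.
have [[u1 u2] rD] := hu; have [[v1 v2] sD] := hv.
have W x : local_compl A D x -> star v * T * u * x = x * (star v * T * u).
  move=> Dx; have := hT x; rewrite rD // sD // /Ad => E.
  have : star v * (T * (u * x * star u)) * u
      = star v * (v * x * star v * T) * u.
    by rewrite E.
  by rewrite !mulrA v1 mul1r -(mulrA _ (star u)) u1 mulr1.
have := incl_commutant i dA dB W Dy.
rewrite !(star_homM hi) (star_homS hi) fD // gD // /Ad => E.
have : i v * (star (i v) * i T * i u * y) * star (i u)
    = i v * (y * (star (i v) * i T * i u)) * star (i u) by rewrite E.
by rewrite !mulrA iv2 mul1r -(mulrA _ (i u) (star (i u))) iu2 mulr1.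
Qed.

Lemma extends_unique rho f g : transportable rho ->
  extends rho f -> extends rho g -> f = g.
Proof.
move=> tr ef eg; apply: funext => y.
have := extends_intertwiner (T := 1) tr tr ef eg _ y.
rewrite (star_hom1 hi) mul1r mulr1; apply => x.
by rewrite mul1r mulr1.
Qed.

(** If [D1] and [D2] lie in one double cone [c] of O', then [star u1 * u2]
    commutes with A(c'), so its image is in B(c) and commutes with B(O). Chains
    of double cones give the general case. *)
Lemma implements_path_independent rho O D1 D2 u1 u2 y : transportable rho ->
  D1 `<=` spacelike_compl O -> D2 `<=` spacelike_compl O ->
  implements u1 rho D1 -> implements u2 rho D2 -> local B O y ->
  Ad (i u1) y = Ad (i u2) y.
Proof.
move=> tr sep1 sep2 + + Oy; move: u1 u2.
apply: (spacelike_compl_connected (r := fun D1 D2 => forall u1 u2,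
  implements u1 rho D1 -> implements u2 rho D2 -> Ad (i u1) y = Ad (i u2) y)
  s1 _ _ sep1 sep2).
  move=> a b c ab bc u1 u2 h1 h2.
  have [u hu] := transportable_implements b tr.
  by rewrite (ab u1 u) // (bc u u2).
move=> a b c ac bc cO u1 u2 [uu1 h1] [uu2 h2].
apply/Ad_eq; [exact: star_hom_image_unitary|exact: star_hom_image_unitary|].
rewrite -(star_homS hi) -(star_homM hi).
apply: (incl_commutant (O := c) i dA dB); last exact: local_sub_compl Oy.
move=> x cx; apply/Ad_eq => //; rewrite -h1 -?h2 //; exact: local_compl_anti cx.
Qed.

(** The extension is the limit of the inner automorphisms given by implementing
    unitaries at double cones moving off to spacelike infinity, which on each
    local algebra are eventually constant. *)
Lemma extension_exists rho : transportable rho -> exists f, extends rho f.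
Proof.
move=> tr; have [D esc] := spacelike_escape R (ltnW s1).
have [u hu] := choice (fun n => transportable_implements (D n) tr).
have hAd n : star_hom (Ad (i (u n))).
  by apply: Ad_star_hom; apply: star_hom_image_unitary => //; have [] := hu n.
have stable O D' v y : D' `<=` spacelike_compl O -> implements v rho D' ->
    local B O y -> converges (fun n => Ad (i (u n)) y) (Ad (i v) y).
  move=> sep hv Oy; apply: converges_near_cst; apply: filterS (esc O) => n hn.
  exact: implements_path_independent (hu n) hv Oy.
have [|f hf lim] := star_hom_pointwise_limit hAd (local_generate B).
  move=> y [O _ Oy]; have [n hn] := filter_ex (esc O).
  by exists (Ad (i (u n)) y); exact: stable (hu n) Oy.
exists f; split=> // O v hv.
have iv : unitary (i v) by apply: star_hom_image_unitary => //; have [] := hv.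
split=> //; apply: local_compl_ind => //; first exact: Ad_star_hom.
move=> O1 sep y Oy; apply: (converges_unique (lim y)).
by apply: stable hv Oy; exact: spacelike_sym.
Qed.

Lemma extends_incl rho f : star_hom rho -> transportable rho -> extends rho f ->
  forall x, f (i x) = i (rho x).
Proof.
move=> hr tr [hf ef] x.
have : cstar_generated (\bigcup_O local A O) x by rewrite local_generate.
apply: (star_hom_eq_ind (comp_star_hom hf hi) (comp_star_hom hi hr)).
move=> {}x [O _ Ox] /=; have [D /(_ _ Ox) Dx] := local_in_compl A s1 O.
have [u hu] := transportable_implements D tr; have [_ fD] := ef _ _ hu.
have [_ ->] := hu; last exact: Dx.
rewrite fD; last exact: local_compl_incl.
by rewrite /Ad !(star_homM hi) (star_homS hi).
Qed.

Lemma extends_of_implements rho f : star_hom f ->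
  (forall O, exists2 u, implements u rho O & implements (i u) f O) ->
  extends rho f.
Proof.
move=> hf h; split=> // O v hv; have [u hu hiu] := h O.
exact: implements_incl hu hiu hv.
Qed.

Lemma extends_localized rho f O :
  extends rho f -> localized rho O -> localized f O.
Proof.
move=> [_ ef] /localized_implements /ef; rewrite (star_hom1 hi).
by move=> /localized_implements.
Qed.

Lemma extends_transportable rho f : transportable rho -> extends rho f ->
  transportable f.
Proof.
move=> tr [_ ef] O; have [u /ef hu] := transportable_implements O tr.
exists (star (i u)); last exact: implements_localized.
by apply: unitary_star; have [] := hu.
Qed.

Lemma extends_id : extends id id.
Proof.
apply: extends_of_implements => [|O]; first exact: star_hom_id.
exists 1; first exact/localized_implements.
by rewrite (star_hom1 hi); exact/localized_implements.
Qed.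

(** If [u] and [v] implement [rho] and [sigma] at [O], then [rho v * u]
    implements the composite, and [i] sends it to [f (i v) * i u]. *)
Lemma extends_comp rho sigma f g :
    star_hom rho -> transportable rho -> transportable sigma ->
    extends rho f -> extends sigma g -> extends (rho \o sigma) (f \o g).
Proof.
move=> hr tr ts ef eg; have [hf irho] := ef; have [hg isigma] := eg.
apply: extends_of_implements => [|O]; first exact: comp_star_hom.
have [u hu] := transportable_implements O tr.
have [v hv] := transportable_implements O ts.
have [[uu hu'] [uv hv']] := (hu, hv).
have [iuu fu] := irho _ _ hu; have [iuv gv] := isigma _ _ hv.
have uw : unitary (rho v * u).
  by apply: unitaryM => //; exact: star_hom_image_unitary.
exists (rho v * u).
  split=> // x hx /=; rewrite hv' // AdM -hu' //.
  by rewrite /Ad !(star_homM hr) (star_homS hr).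
split; first exact: star_hom_image_unitary.
move=> y hy /=.
rewrite gv // (star_homM hi) AdM -fu // -(extends_incl hr tr ef).
by rewrite /Ad !(star_homM hf) (star_homS hf).
Qed.

(** A field value [z b] with [d0 b = a] implements the endomorphism at [d1 b];
    conversely implementing unitaries [u], normalized by [u a = 1], give the
    coboundary [star (u (d0 b)) * u (d1 b)]. *)
Lemma canonical_extensionP (rho : lt_endo A) f :
  canonical_extension i rho f <-> extends rho f.
Proof.
have tr := lt_transportable rho; split.
  case=> hf [a [z [_ [zu _ _] zrho zf]]].
  apply: extends_of_implements => // O.
  have [c [ac Oc]] := double_cone_directed a O.
  have acO : a `|` O `<=` c by rewrite subUset.
  pose b := Simplex1 acO.
  have uz := zu b; have iuz := star_hom_image_unitary hi uz.
  exists (z b); split=> //.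
    apply: local_compl_ind; [exact: lt_star_hom|exact: Ad_star_hom|].
    by move=> O1 sep x Ox; apply: zrho Ox _ _ => //=; exact: spacelike_sym.
  apply: local_compl_ind => //; first exact: Ad_star_hom.
  by move=> O1 sep x Ox; apply: zf Ox _ _ => //=; exact: spacelike_sym.
move=> [hf ef]; split=> //; have [a ha] := lt_localized rho.
have /choice[u hu] : forall c : double_cone R s,
    exists v, implements v rho c /\ (c = a -> v = 1).
  move=> c.
  have [->|ca] := pselect (c = a).
    by exists 1; split=> //; exact/localized_implements.
  by have [u hu] := transportable_implements c tr; exists u; split=> // /ca.
have ui c : implements (u c) rho c by have [] := hu c.
have uu c : unitary (u c) by have [] := ui c.
exists a, (fun b => star (u (d0 b)) * u (d1 b)); split=> //.
- split=> [b|b|c].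
  + by apply: unitaryM => //; exact: unitary_star.
  + rewrite dA /= => x hx; apply/Ad_eq => //.
    have [h0 h1] : d0 b `<=` supp1 b /\ d1 b `<=` supp1 b.
      by have := @simplex1P _ _ b; rewrite subUset.
    have [_ <-] := ui (d0 b); last exact: local_compl_anti hx.
    by have [_ <-] := ui (d1 b); last exact: local_compl_anti hx.
  + by rewrite /= mulrA -(mulrA _ (u _)) (proj2 (uu _)) mulr1.
- move=> O x b Ox d0a sep.
  have [_ ->] := ui (d1 b); last exact: local_sub_compl Ox.
  by rewrite d0a (proj2 (hu a)) // star1 mul1r.
- move=> O x b Ox d0a sep /=; rewrite d0a (proj2 (hu a)) // star1 mul1r.
  by have [_ ->] := ef _ _ (ui (d1 b)); last exact: local_sub_compl Ox.
Qed.

End Extension.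

(** * The induced tensor functor *)

Theorem theorem2p2 (R : realType) (s : nat) (A B : net R s)
    (i : net_inclusion A B) :
  (2 < s.+1)%N -> relative_duality A -> relative_duality B ->
  exists F : tensor_star_functor (Tt A) (Tt B),
    [/\ category_inclusion F,
        forall (rho : lt_endo A) (f : B -> B),
          canonical_extension i rho f <-> f = (F rho : lt_endo B)
      & forall (rho sigma : lt_endo A) (T : intertwiner rho sigma),
          arrow (fhom F T : intertwiner (F rho : lt_endo B) (F sigma : lt_endo B))
            = i (arrow T)].
Proof.
rewrite ltnS => s1 dA dB.
have hi := incl_star_hom i.
have tr (rho : lt_endo A) := @lt_transportable _ _ _ rho.
have /choice[ext extP] : forall rho : lt_endo A,
    exists f : lt_endo B, extends i rho f.
  move=> rho.
  have [f ef] := extension_exists i s1 dA dB (tr rho).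
  have loc : exists O, localized f O.
    have [O hO] := lt_localized rho.
    by exists O; exact: extends_localized ef hO.
  by exists (LtEndo (proj1 ef) loc (extends_transportable (tr rho) ef)).
have ext_eq (rho : lt_endo A) f : extends i rho f -> f = ext rho.
  by move=> ef; rewrite (extends_unique s1 dA dB (tr rho) ef (extP rho)).
have ext_incl (rho : lt_endo A) x : ext rho (i x) = i (rho x).
  exact (extends_incl s1 (lt_star_hom rho) (tr rho) (extP rho) x).
have ext_arrow (rho sigma : lt_endo A) (T : intertwiner rho sigma) :
    i (arrow T) \in intertwines (ext rho) (ext sigma).
  apply/asboolP; apply: (extends_intertwiner s1 dA dB (tr rho) (tr sigma)
    (extP rho) (extP sigma)) => x; exact: intertwinerP.
pose ext_hom (rho sigma : lt_endo A) (T : lt_hom rho sigma) :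
    lt_hom (ext rho) (ext sigma) := Intertwiner (ext_arrow rho sigma T).
have ext_id : ext (lt_id A) = lt_id B.
  by apply: lt_endo_eq; rewrite -(ext_eq (lt_id A) _ (extends_id i dA dB)).
have ext_comp (rho sigma : lt_endo A) :
    ext (lt_comp rho sigma) = lt_comp (ext rho) (ext sigma).
  apply: lt_endo_eq.
  rewrite -(ext_eq (lt_comp rho sigma) (ext rho \o ext sigma)) //.
  exact (extends_comp s1 dA dB (lt_star_hom rho) (tr rho) (tr sigma)
    (extP rho) (extP sigma)).
unshelve eexists.
  refine (@TensorStarFunctor R (Tt A) (Tt B) ext ext_hom
    _ _ _ _ ext_id ext_comp _).
  - by move=> x y k S T; apply: intertwiner_eq; case: hi => hl _ _; exact: hl.
  - by move=> x; apply: intertwiner_eq; exact: star_hom1 hi.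
  - by move=> x y z S T; apply: intertwiner_eq; exact: star_homM hi _ _.
  - by move=> x y T; apply: intertwiner_eq; exact: star_homS hi _.
  - move=> x y x' y' S T; apply: intertwiner_eq; rewrite lt_hom_cast /=.
    by rewrite (star_homM hi) -ext_incl.
split=> //=.
- split=> [rho sigma E|rho sigma S T /(congr1 val) /= /(@incl_inj _ _ _ _ i)].
    apply: lt_endo_eq; apply: funext => x; apply: (@incl_inj _ _ _ _ i).
    by rewrite -!ext_incl; congr (lt_fun _ (i x)); exact: E.
  exact: intertwiner_eq.
- move=> rho f; split=> [/(canonical_extensionP i dA dB)|->]; first exact: ext_eq.
  exact/(canonical_extensionP i dA dB).
Qed.
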